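(* Let $(a_n)_{n\in\mathbb N}$ be a strictly positive real sequence with $a_n\to0$ and $\sqrt n\,a_n\to\infty$. Let $\rho_{AB}\in\mathcal S(AB)$ with $V(A:B)_\rho>0$, and put $R_n:=I(A:B)_\rho+a_n$. Then $$\lim_{n\to\infty}-\frac{1}{na_n^2}\log\big(1-\hat\alpha_{n,\rho}(e^{-nR_n})\big)=\frac{1}{2V(A:B)_\rho},$$ and the same holds with $\hat\alpha_{n,\rho}$ replaced by $\hat\alpha^{\mathrm{iid}}_{n,\rho}$.
   Context: All Hilbert spaces are finite-dimensional, $\log$ is natural, $\mathcal S(A)$ is the set of density operators on $A$. $I(A:B)_\rho=H(A)_\rho+H(B)_\rho-H(AB)_\rho$; $V(A:B)_\rho=\operatorname{tr}[\rho_{AB}(\log\rho_{AB}-\log(\rho_A\otimes\rho_B)-I(A:B)_\rho)^2]$. $\mathcal S_{\mathrm{sym}}(A^{\otimes n})$: permutation-invariant states. $\hat\alpha_{n,\rho}(\mu)=\min\{\operatorname{tr}[\rho_{AB}^{\otimes n}(1-T)]:0\le T\le1,\ \max_{\sigma_{A^n}\in\mathcal S_{\mathrm{sym}}(A^{\otimes n}),\tau_{B^n}\in\mathcal S_{\mathrm{sym}}(B^{\otimes n})}\operatorname{tr}[(\sigma_{A^n}\otimes\tau_{B^n})T]\le\mu\}$; $\hat\alpha^{\mathrm{iid}}_{n,\rho}(\mu)=\min\{\operatorname{tr}[\rho_{AB}^{\otimes n}(1-T)]:0\le T\le1,\ \max_{\sigma_A\in\mathcal S(A),\tau_B\in\mathcal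 S(B)}\operatorname{tr}[(\sigma_A^{\otimes n}\otimes\tau_B^{\otimes n})T]\le\mu\}$. *)

(* Defs.v *)
From HB Require Import structures.
From mathcomp Require Import all_boot all_order all_algebra.
From mathcomp Require Import fingroup perm complex mxtens.
From mathcomp Require Import all_classical all_reals.
From mathcomp Require Import topology normedtype sequences exp.

Set Implicit Arguments.
Unset Strict Implicit.
Unset Printing Implicit Defensive.

Import Order.TTheory GRing.Theory Num.Theory.
Local Open Scope ring_scope.

Section QI.
Variable R : realType.
Local Notation C := R[i].

Definition psd n (M : 'M[C]_n) : Prop :=
  forall v : 'rV[C]_n, 0 <= (v *m M *m (map_mx Num.conj v)^T) 0 0.

Definition density n (M : 'M[C]_n) : Prop := psd M /\ \tr M = 1.

Definition test_op n (T : 'M[C]_n) : Prop := psd T /\ psd (1%:M - T).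

(* Matrix logarithm via the spectral decomposition (natural log of the real part of each
   eigenvalue; on the kernel ln 0 = 0, i.e. the log is taken on the support, which does not
   affect H, I or V below). *)
Definition logm n (M : 'M[C]_n) : 'M[C]_n :=
  invmx (spectralmx M) *m
  diag_mx (map_mx (fun z : C => Complex (ln (complex.Re z)) 0) (spectral_diag M)) *m
  spectralmx M.

Definition entropy n (M : 'M[C]_n) : R := - complex.Re (\tr (M *m logm M)).

Definition ptraceB dA dB (rho : 'M[C]_(dA * dB)) : 'M[C]_dA :=
  \matrix_(a, a') \sum_(b < dB) rho (mxtens_index (a, b)) (mxtens_index (a', b)).
Definition ptraceA dA dB (rho : 'M[C]_(dA * dB)) : 'M[C]_dB :=
  \matrix_(b, b') \sum_(a < dA) rho (mxtens_index (a, b)) (mxtens_index (a, b')).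

Definition mutual_info dA dB (rho : 'M[C]_(dA * dB)) : R :=
  entropy (ptraceB rho) + entropy (ptraceA rho) - entropy rho.

Definition mutual_info_var dA dB (rho : 'M[C]_(dA * dB)) : R :=
  let L := logm rho - logm (ptraceB rho *t ptraceA rho)
           - (Complex (mutual_info rho) 0)%:M in
  complex.Re (\tr (rho *m (L *m L))).

End QI.

(* k-th base-d digit of an index of (C^d)^{(x) n}; i = sum_k digit i k * d^k *)
Lemma digit_proof d n (i : 'I_(d ^ n)) (k : 'I_n) : (modn (divn i (expn d k)) d < d)%N.
Proof.
rewrite ltn_mod.
have hp : (0 < expn d n)%N by apply: leq_ltn_trans (ltn_ord i).
have hk := ltn_ord k.
move: hp hk; clear i; case: d => [|d] // hp hk.
by move: hp; case: n k hk => [|n] k hk; rewrite ?exp0n.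
Qed.

Definition digit d n (i : 'I_(d ^ n)) (k : 'I_n) : 'I_d := Ordinal (digit_proof i k).

Section TensorPowers.
Variable R : realType.
Local Notation C := R[i].
Local Open Scope ring_scope.

Definition tpow d n (M : 'M[C]_d) : 'M[C]_(d ^ n) :=
  \matrix_(i, j) \prod_(k < n) M (digit i k) (digit j k).

(* rho_AB^{(x) n}, as an operator on A^n B^n = (C^dA)^{(x) n} (x) (C^dB)^{(x) n} *)
Definition tpowAB dA dB n (rho : 'M[C]_(dA * dB)) : 'M[C]_(dA ^ n * dB ^ n) :=
  \matrix_(i, j) \prod_(k < n)
     rho (mxtens_index (digit (mxtens_unindex i).1 k, digit (mxtens_unindex i).2 k))
         (mxtens_index (digit (mxtens_unindex j).1 k, digit (mxtens_unindex j).2 k)).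

(* permutation invariance: P_pi sigma P_pi^dagger = sigma for every pi in S_n,
   where P_pi permutes the n tensor factors *)
Definition perm_inv d n (sigma : 'M[C]_(d ^ n)) : Prop :=
  forall (p : 'S_n) (i j i' j' : 'I_(d ^ n)),
    (forall k, digit i' k = digit i (p k)) ->
    (forall k, digit j' k = digit j (p k)) ->
    sigma i' j' = sigma i j.

(* \hat alpha_{n,rho}(mu) (the min is attained; written as an infimum) *)
Definition alpha_hat dA dB n (rho : 'M[C]_(dA * dB)) (mu : R) : R :=
  inf [set x : R | exists T : 'M[C]_(dA ^ n * dB ^ n),
        [/\ test_op T,
            (forall (sigma : 'M[C]_(dA ^ n)) (tau : 'M[C]_(dB ^ n)),
               density sigma -> perm_inv sigma -> density tau -> perm_inv tau ->
               complex.Re (\tr ((sigma *t tau) *m T)) <= mu)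
          & x = complex.Re (\tr (tpowAB n rho *m (1%:M - T)))]].

Definition alpha_hat_iid dA dB n (rho : 'M[C]_(dA * dB)) (mu : R) : R :=
  inf [set x : R | exists T : 'M[C]_(dA ^ n * dB ^ n),
        [/\ test_op T,
            (forall (sigma : 'M[C]_dA) (tau : 'M[C]_dB),
               density sigma -> density tau ->
               complex.Re (\tr ((tpow n sigma *t tpow n tau) *m T)) <= mu)
          & x = complex.Re (\tr (tpowAB n rho *m (1%:M - T)))]].

End TensorPowers.

(* Main.v *)
(* For spectral decompositions rho = sum_i l_i |x_i><x_i| and sigma = sum_j m_j |y_j><y_j|,
   the weights l_i |<x_i|y_j>|^2 form a probability law P on pairs (i, j), and V is the
   variance of ln l_i - ln m_j under P for sigma = rho_A (x) rho_B.  For n copies the law is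
   that of a sum of n independent copies, whose moderate deviations give the rate 1 / (2 V).
   Both directions must avoid polynomial prefactors on 1 - alpha, because n a_n^2 may grow
   more slowly than ln n; factors e^(o(n a_n)) on the type-II constraint are harmless.

   Converse: testing only sigma = rho_A, tau = rho_B, expand tr(rho^n T) in both eigenbases
   and apply AM-GM, with different weights according to whether l_i / m_j is large:
   tr(rho^n T) <= P(l_i > E m_j) + 2 e^-x if E is e^(2 x) times smaller than the inverse
   constraint.

   Achievability: every symmetric state is dominated by an operator Z commuting with all
   symmetric operators and with polynomial trace.  Choose y_j as a joint eigenbasis of
   rho_A^n (x) rho_B^n and Z_A (x) Z_B.  Orthogonalising the vectors x_i, cut off to the y_j
   whose Z-eigenvalue z_j is below l_i / E, by increasing l_i gives a test that is feasible
   for all symmetric states and has tr(rho^n T) >= P(l_i >= E z_j).  By Markov's inequality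
   z_j exceeds e^(2 x) m_j only with probability e^-x times a polynomial, and x can be taken
   as a small multiple of n a_n, which dominates n a_n^2. *)

Require Import Defs.
From HB Require Import structures.
From mathcomp Require Import all_boot all_order all_algebra.
From mathcomp Require Import fingroup perm complex mxtens.
From mathcomp Require Import all_classical all_reals.
From mathcomp Require Import topology normedtype sequences exp.
From mathcomp Require Import derive realfun.
From mathcomp Require Import ring lra.

Import Order.TTheory GRing.Theory Num.Theory.
Import numFieldNormedType.Exports.
Local Open Scope classical_set_scope.
Local Open Scope ring_scope.

Set Implicit Arguments.
Unset Strict Implicit.
Unset Printing Implicit Defensive.

(** * Spectral calculus *)

Section LinearAlgebra.
Variable R : realType.
Local Notation C := R[i].
Local Notation Re := complex.Re.
Local Notation Im := complex.Im.
Local Open Scope complex_scope.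

Lemma conjCR (x : R) : Num.conj (x%:C : C) = x%:C.
Proof. exact: conjc_real. Qed.

Definition adjmx m n (M : 'M[C]_(m, n)) : 'M[C]_(n, m) := (map_mx Num.conj M)^T.

Lemma adjmxE m n (M : 'M[C]_(m, n)) i j : adjmx M i j = Num.conj (M j i).
Proof. by rewrite !mxE. Qed.

Lemma adjmxK m n (M : 'M[C]_(m, n)) : adjmx (adjmx M) = M.
Proof. by apply/matrixP => i j; rewrite !adjmxE conjCK. Qed.

Lemma adjmxM m n p (M : 'M[C]_(m, n)) (N : 'M[C]_(n, p)) :
  adjmx (M *m N) = adjmx N *m adjmx M.
Proof. by rewrite /adjmx map_mxM trmx_mul. Qed.

Lemma adjmxD m n (M N : 'M[C]_(m, n)) : adjmx (M + N) = adjmx M + adjmx N.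
Proof. by rewrite /adjmx map_mxD linearD. Qed.

Lemma adjmxB m n (M N : 'M[C]_(m, n)) : adjmx (M - N) = adjmx M - adjmx N.
Proof. by rewrite /adjmx map_mxB linearB. Qed.

Lemma adjmx1 n : adjmx (1%:M : 'M[C]_n) = 1%:M.
Proof. by rewrite /adjmx map_mx1 trmx1. Qed.

Lemma adjmxZ m n (c : R) (M : 'M[C]_(m, n)) : adjmx (c%:C *: M) = c%:C *: adjmx M.
Proof.
by apply/matrixP => i j; rewrite !(adjmxE, mxE) rmorphM /= conjCR.
Qed.

Lemma adjmx_tens m n p q (M : 'M[C]_(m, n)) (N : 'M[C]_(p, q)) :
  adjmx (M *t N) = adjmx M *t adjmx N.
Proof. by rewrite /adjmx map_mxT trmx_tens. Qed.

Lemma adjmx_sumZ (I : Type) (r : seq I) m n (c : I -> C) (F : I -> 'M[C]_(m, n)) :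
  adjmx (\sum_(t <- r) c t *: F t) = \sum_(t <- r) Num.conj (c t) *: adjmx (F t).
Proof.
apply/matrixP => i j; rewrite adjmxE !summxE rmorph_sum; apply: eq_bigr => t _.
by rewrite mxE rmorphM [RHS]mxE adjmxE.
Qed.

Lemma mxtrace_adj n (M : 'M[C]_n) : \tr (adjmx M) = Num.conj (\tr M).
Proof. by rewrite /mxtrace rmorph_sum; apply: eq_bigr => i _; rewrite adjmxE. Qed.

(** Real-valued, whereas the norm on [R[i]] takes values in [R[i]] again. *)
Definition sqnorm (z : C) : R := (Re z) ^+ 2 + (Im z) ^+ 2.

Lemma sqnormE z : (sqnorm z)%:C = z * Num.conj z.
Proof. by case: z => a b; rewrite /sqnorm /=; simpc; congr Complex; ring. Qed.

Lemma sqnorm_ge0 z : 0 <= sqnorm z.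
Proof. by rewrite addr_ge0 ?sqr_ge0. Qed.

Lemma sqnorm_eq0 z : (sqnorm z == 0) = (z == 0).
Proof.
by case: z => a b; rewrite /sqnorm paddr_eq0 ?sqr_ge0 //= !sqrf_eq0 eq_complex.
Qed.

Lemma sqnormM z w : sqnorm (z * w) = sqnorm z * sqnorm w.
Proof. by case: z w => [a b] [c d]; rewrite /sqnorm; simpc => /=; ring. Qed.

Lemma sqnorm_conj z : sqnorm (Num.conj z) = sqnorm z.
Proof. by case: z => a b; rewrite /sqnorm /= sqrrN. Qed.

Lemma Re_sum (I : Type) (r : seq I) (P : pred I) (F : I -> C) :
  Re (\sum_(i <- r | P i) F i) = \sum_(i <- r | P i) Re (F i).
Proof. exact: (raddf_sum (@complex.Re R : Rcomplex R -> R)). Qed.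

Lemma ReD (x y : C) : Re (x + y) = Re x + Re y.
Proof. exact: (raddfD (@complex.Re R : Rcomplex R -> R)). Qed.

Lemma ReB (x y : C) : Re (x - y) = Re x - Re y.
Proof. exact: (raddfB (@complex.Re R : Rcomplex R -> R)). Qed.

Lemma Re_mulr (c : R) (z : C) : Re (c%:C * z) = c * Re z.
Proof. by case: z => a b /=; rewrite mul0r subr0. Qed.

Lemma real_complex_sum (I : Type) (r : seq I) (P : pred I) (F : I -> R) :
  (\sum_(i <- r | P i) F i)%:C = \sum_(i <- r | P i) (F i)%:C.
Proof. exact: (raddf_sum (real_complex R)). Qed.

Definition diagC n (d : 'I_n -> R) : 'M[C]_n := diag_mx (\row_i (d i)%:C).

Lemma diagCE n (d : 'I_n -> R) i j : diagC d i j = (d i)%:C *+ (i == j).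
Proof. by rewrite !mxE. Qed.

Lemma adjmx_diagC n (d : 'I_n -> R) : adjmx (diagC d) = diagC d.
Proof.
apply/matrixP => i j; rewrite adjmxE !diagCE rmorphMn /= conjCR eq_sym.
by case: eqP => [->|]; rewrite ?mulr0n.
Qed.

Lemma diagCM n (d e : 'I_n -> R) : diagC d *m diagC e = diagC (fun i => d i * e i).
Proof.
apply/matrixP => i j; rewrite mul_diag_mx [LHS]mxE !diagCE mxE.
by case: (i == j); rewrite ?mulr1n ?mulr0n ?mulr0 // -rmorphM.
Qed.

Lemma mul_diagCl m n (d : 'I_m -> R) (M : 'M[C]_(m, n)) i j :
  (diagC d *m M) i j = (d i)%:C * M i j.
Proof. by rewrite mul_diag_mx !mxE. Qed.

Lemma mul_diagCr m n (d : 'I_n -> R) (M : 'M[C]_(m, n)) i j :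
  (M *m diagC d) i j = M i j * (d j)%:C.
Proof. by rewrite mul_mx_diag !mxE. Qed.

Definition unitary n (U : 'M[C]_n) := U *m adjmx U = 1%:M.

Lemma unitaryV n (U : 'M[C]_n) : unitary U -> adjmx U *m U = 1%:M.
Proof. exact: mulmx1C. Qed.

Lemma unitary_tens m n (U : 'M[C]_m) (W : 'M[C]_n) :
  unitary U -> unitary W -> unitary (U *t W).
Proof.
rewrite /unitary adjmx_tens tensmx_mul => -> ->.
apply/matrixP => i j; case: (mxtens_indexP i) => a b; case: (mxtens_indexP j) => c e.
by rewrite tensmxE !mxE (can_eq (@mxtens_indexK _ _)) xpair_eqE -natrM mulnb.
Qed.

(** The rows of [U] form the eigenbasis, so a function of the matrix is obtained by composing it
    with [d]. Locked so that rewriting does not see through to the product. *)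
Definition fcalc n (U : 'M[C]_n) (d : 'I_n -> R) : 'M[C]_n :=
  locked (adjmx U *m diagC d *m U).

Lemma fcalcE n (U : 'M[C]_n) d : fcalc U d = adjmx U *m diagC d *m U.
Proof. by rewrite /fcalc -lock. Qed.

Lemma adjmx_fcalc n (U : 'M[C]_n) d : adjmx (fcalc U d) = fcalc U d.
Proof. by rewrite !fcalcE !adjmxM adjmxK adjmx_diagC mulmxA. Qed.

Lemma fcalcM n (U : 'M[C]_n) d e : unitary U ->
  fcalc U d *m fcalc U e = fcalc U (fun i => d i * e i).
Proof.
move=> hU; rewrite !fcalcE -(diagCM d e) !mulmxA -(mulmxA _ U) hU mulmx1.
exact.
Qed.

Lemma fcalc_conj n (U : 'M[C]_n) d : unitary U -> U *m fcalc U d *m adjmx U = diagC d.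
Proof.
by move=> hU; rewrite !fcalcE !mulmxA hU mul1mx -mulmxA hU mulmx1.
Qed.

(* If both diagonalise the same matrix, the change of basis only mixes equal eigenvalues. *)
Lemma fcalc_unique n (U W : 'M[C]_n) d e (f : R -> R) : unitary U -> unitary W ->
  fcalc U d = fcalc W e -> fcalc U (f \o d) = fcalc W (f \o e).
Proof.
move=> hU hW h; pose V := U *m adjmx W.
have hV : diagC d *m V = V *m diagC e.
  rewrite -(fcalc_conj d hU) h /V !fcalcE !mulmxA -!(mulmxA _ (adjmx U)).
  by rewrite (unitaryV hU) mulmx1 -!(mulmxA _ W) hW mulmx1.
have hfV : diagC (f \o d) *m V = V *m diagC (f \o e).
  apply/matrixP => i j; move/matrixP: hV => /(_ i j).
  rewrite !mul_diagCl !mul_diagCr => hij.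
  have [->|nz] := eqVneq (V i j) 0; first by rewrite mulr0 mul0r.
  move: hij; rewrite mulrC => /(mulfI nz) [hde].
  by rewrite mulrC /= hde.
have := congr1 (fun X => adjmx U *m X *m W) hfV.
rewrite /V !mulmxA (unitaryV hU) mul1mx -(mulmxA _ (adjmx W)) (unitaryV hW) mulmx1.
by rewrite !fcalcE.
Qed.

Lemma fcalc_tens m n (U : 'M[C]_m) (W : 'M[C]_n) d e :
  fcalc U d *t fcalc W e
  = fcalc (U *t W) (fun k => d (mxtens_unindex k).1 * e (mxtens_unindex k).2).
Proof.
rewrite !fcalcE adjmx_tens -!tensmx_mul; congr (_ *m _ *m _).
apply/matrixP => i j; case: (mxtens_indexP i) => a b; case: (mxtens_indexP j) => c k.
rewrite tensmxE !diagCE (can_eq (@mxtens_indexK _ _)) xpair_eqE !mxtens_indexK.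
by do 2 case: (_ == _); rewrite ?mulr1n ?mulr0n ?mulr0 ?mul0r // -rmorphM.
Qed.

(** Polarisation: a nonnegative element of [C] is real, and reality of the form on e_i, e_j, e_j +
    e_i and e_j + 'i e_i forces the two off-diagonal entries to be conjugate. *)
Lemma psd_adj n (M : 'M[C]_n) : psd M -> adjmx M = M.
Proof.
move=> hM; apply/matrixP => i j; rewrite adjmxE.
pose v (c : C) : 'rV[C]_n := delta_mx 0 j + c *: delta_mx 0 i.
have hd (k l : 'I_n) : (delta_mx 0 k *m M *m delta_mx l 0 : 'M[C]_1) 0 0 = M k l.
  by rewrite -rowE -colE !mxE.
have hv c : (v c *m M *m adjmx (v c)) 0 0
    = M j j + Num.conj c * M j i + (c * M i j + c * Num.conj c * M i i).
  have -> : adjmx (v c) = delta_mx j 0 + Num.conj c *: delta_mx i 0.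
    by apply/matrixP => k l; rewrite adjmxE !mxE !ord1 eqxx !andbT /= rmorphD rmorphM /= !rmorph_nat.
  have hD (A B : 'M[C]_1) : (A + B) 0 0 = A 0 0 + B 0 0 by rewrite mxE.
  have hZ (A : 'M[C]_1) k : (k *: A) 0 0 = k * A 0 0 by rewrite mxE.
  rewrite /v !(mulmxDl, mulmxDr) -!(scalemxAl, scalemxAr) !(hD, hZ) !hd.
  by rewrite mulrA addrA.
have him (w : 'rV[C]_n) : Im ((w *m M *m adjmx w) 0 0) = 0.
  by apply: ger0_Im; apply: hM.
have hkk k : Im (M k k) = 0.
  have := him (delta_mx 0 k).
  by rewrite /adjmx map_delta_mx trmx_delta hd.
have h1 := him (v 1); rewrite hv in h1.
have h2 := him (v 'i); rewrite hv in h2.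
move: h1 h2 (hkk i) (hkk j).
case: (M j j) (M j i) (M i j) (M i i) => [a a'] [b b'] [c c'] [d d'] /=.
by simpc => /= h1 h2 h3 h4; congr Complex; lra.
Qed.
End LinearAlgebra.

(** * Positive semidefinite matrices and tests *)

Section Psd.
Variable R : realType.
Local Notation C := R[i].
Local Notation Re := complex.Re.
Local Open Scope complex_scope.

Lemma psd_gram m n (X : 'M[C]_(m, n)) : psd (X *m adjmx X).
Proof.
move=> v; rewrite -/(adjmx v) mulmxA -mulmxA -adjmxM mxE.
by apply: sumr_ge0 => k _; rewrite adjmxE mul_conjC_ge0.
Qed.

Lemma psd_fcalc n (U : 'M[C]_n) d : (forall i, 0 <= d i) -> psd (fcalc U d).
Proof.
move=> hd; suff -> : fcalc U d =
  (adjmx U *m diagC (Num.sqrt \o d)) *m adjmx (adjmx U *m diagC (Num.sqrt \o d)).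
  exact: psd_gram.
rewrite adjmxM adjmxK adjmx_diagC mulmxA -(mulmxA (adjmx U)) diagCM !fcalcE.
congr (_ *m diagC _ *m _); apply/funext => i /=.
by rewrite -expr2 sqr_sqrtr.
Qed.

Lemma fcalc_diag n (U : 'M[C]_n) d i : unitary U ->
  (row i U *m fcalc U d *m adjmx (row i U)) 0 0 = (d i)%:C.
Proof.
move=> hU; have := congr1 (fun X : 'M[C]_n => X i i) (fcalc_conj d hU).
rewrite /= diagCE eqxx mulr1n => <-.
rewrite !mxE; apply: eq_bigr => k _; rewrite !adjmxE !mxE; congr (_ * _).
by apply: eq_bigr => l _; rewrite mxE.
Qed.

Lemma psd_fcalc_ge0 n (U : 'M[C]_n) d i : unitary U -> psd (fcalc U d) -> 0 <= d i.
Proof. by move=> hU /(_ (row i U)); rewrite -/(adjmx _) fcalc_diag // ler0c. Qed.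

Lemma fcalcB n (U : 'M[C]_n) d e : fcalc U d - fcalc U e = fcalc U (fun i => d i - e i).
Proof.
rewrite !fcalcE -mulmxBl -mulmxBr; congr (_ *m _ *m _).
by apply/matrixP => i j; rewrite !mxE -mulrnBl -rmorphB.
Qed.

Lemma fcalc1 n (U : 'M[C]_n) : unitary U -> fcalc U (fun=> 1) = 1%:M.
Proof.
move=> hU; rewrite !fcalcE (_ : diagC _ = 1%:M) ?mulmx1 ?unitaryV //.
by apply/matrixP => i j; rewrite !mxE.
Qed.

(** The spectral theorem for the very decomposition on which [logm] is built; [fcalc_logm] later
    transfers the logarithm to any other one. *)
Lemma psd_spectral n (M : 'M[C]_n) (U := spectralmx M)
    (d := fun i => Re (spectral_diag M 0 i)) : psd M ->
  [/\ unitary U, forall i, 0 <= d i, M = fcalc U d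
    & logm M = fcalc U (fun i => ln (d i))].
Proof.
move=> hM; have hU : unitary U.
  have /unitarymxP := spectral_unitarymx M.
  by rewrite /unitary /adjmx map_trmx.
have hiU : invmx U = adjmx U.
  by have /unitarymxP := spectral_unitarymx M; rewrite invmx_unitary ?spectral_unitarymx // /adjmx map_trmx.
have hn : M \is hermsymmx.
  by apply/is_hermitianmxP; rewrite expr0 scale1r -{1}(psd_adj hM) /adjmx map_trmx.
have /orthomx_spectralP hs := hermitian_normalmx hn.
have /mxOverP hr := hermitian_spectral_diag_real hn.
have hM' : M = fcalc U d.
  rewrite {1}hs hiU !fcalcE; congr (_ *m _ *m _).
  by congr diag_mx; apply/rowP => i; rewrite mxE RRe_real.
split; [exact: hU| |exact: hM'|].
  by move=> i; apply: (@psd_fcalc_ge0 _ _ d i hU); rewrite -hM'; exact: hM.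
rewrite /logm hiU fcalcE; congr (_ *m _ *m _).
by congr diag_mx; apply/rowP => i; rewrite !mxE.
Qed.

Lemma psd_fcalcP n (M : 'M[C]_n) : psd M ->
  exists U d, [/\ unitary U, forall i, 0 <= d i & M = fcalc U d].
Proof.
move=> /psd_spectral[hU hd hM _].
by exists (spectralmx M), (fun i => Re (spectral_diag M 0 i)).
Qed.

Lemma psd_gramP n (M : 'M[C]_n) : psd M -> exists X : 'M[C]_n, M = X *m adjmx X.
Proof.
move=> /psd_fcalcP[U [d [hU hd ->]]].
exists (fcalc U (Num.sqrt \o d)).
rewrite adjmx_fcalc fcalcM //; congr fcalc; apply/funext => i /=.
by rewrite -expr2 sqr_sqrtr.
Qed.

Lemma psdD n (M N : 'M[C]_n) : psd M -> psd N -> psd (M + N).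
Proof. by move=> hM hN v; rewrite mulmxDr mulmxDl mxE addr_ge0. Qed.

Lemma psd0 n : psd (0 : 'M[C]_n).
Proof. by move=> v; rewrite mulmx0 mul0mx mxE. Qed.

Lemma psd1 n : psd (1%:M : 'M[C]_n).
Proof. by have := psd_gram (1%:M : 'M[C]_n); rewrite adjmx1 mulmx1. Qed.

Lemma psd_tens m n (M : 'M[C]_m) (N : 'M[C]_n) : psd M -> psd N -> psd (M *t N).
Proof.
move=> /psd_gramP[X ->] /psd_gramP[Y ->].
rewrite -tensmx_mul -adjmx_tens; exact: psd_gram.
Qed.

Lemma mxtrace_gram m n (X : 'M[C]_(m, n)) :
  \tr (X *m adjmx X) = (\sum_i \sum_j sqnorm (X i j))%:C.
Proof.
rewrite /mxtrace real_complex_sum; apply: eq_bigr => i _.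
rewrite mxE real_complex_sum; apply: eq_bigr => j _.
by rewrite adjmxE sqnormE.
Qed.

(** For M = X adj(X) and N = Y adj(Y), cyclicity turns the trace into the squared Hilbert-Schmidt
    norm of adj(X) Y. *)
Lemma mxtrace_psd_mul_ge0 n (M N : 'M[C]_n) : psd M -> psd N -> 0 <= Re (\tr (M *m N)).
Proof.
move=> /psd_gramP[X ->] /psd_gramP[Y ->].
rewrite -mulmxA mxtrace_mulC -!mulmxA mulmxA.
have -> : (adjmx X *m Y) *m (adjmx Y *m X) = (adjmx X *m Y) *m adjmx (adjmx X *m Y).
  by rewrite adjmxM adjmxK.
by rewrite mxtrace_gram; apply: sumr_ge0 => i _; apply: sumr_ge0 => j _; apply: sqnorm_ge0.
Qed.

Lemma mxtrace_psd_le n (M N T : 'M[C]_n) : psd T -> psd (N - M) ->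
  Re (\tr (M *m T)) <= Re (\tr (N *m T)).
Proof.
move=> hT hMN; rewrite -subr_ge0 -ReB -linearB /= -mulmxBl.
exact: mxtrace_psd_mul_ge0.
Qed.

Lemma test_op_proj n (P : 'M[C]_n) : adjmx P = P -> P *m P = P -> test_op P.
Proof.
move=> h1 h2; split; first by rewrite -h2 -{2}h1; apply: psd_gram.
have -> : 1%:M - P = (1%:M - P) *m adjmx (1%:M - P).
  by rewrite adjmxB adjmx1 h1 mulmxBl mul1mx mulmxBr mulmx1 h2 subrr subr0.
exact: psd_gram.
Qed.

Lemma test_op0 n : test_op (0 : 'M[C]_n).
Proof. by split; [apply: psd0 | rewrite subr0; apply: psd1]. Qed.

(** The eigenvalues of a test lie in [0, 1], hence T^2 <= T. This lets the converse use the squared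
    moduli of the entries of T although T need not be a projection. *)
Lemma mxtrace_test_sq n (M T : 'M[C]_n) : psd M -> test_op T ->
  Re (\tr (M *m (T *m T))) <= Re (\tr (M *m T)).
Proof.
move=> hM [hT hT']; rewrite -subr_ge0 -ReB -linearB /= -mulmxBr.
apply: mxtrace_psd_mul_ge0 => //.
have [U [d [hU hd hTU]]] := psd_fcalcP hT.
rewrite {1}hTU in hT'; rewrite -(fcalc1 hU) fcalcB in hT'.
rewrite hTU fcalcM // fcalcB; apply: psd_fcalc => i.
have := psd_fcalc_ge0 i hU hT'; have := hd i.
by move: (d i) => x; nra.
Qed.
End Psd.

(** * Tests for a pair of spectral decompositions *)

Section HypothesisTesting.
Variable R : realType.
Local Notation C := R[i].
Local Notation Re := complex.Re.
Local Open Scope complex_scope.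

(* The weights lambda_i * overlap U W i j form the Nussbaum-Szkola distribution of the
   pair (fcalc U lambda, fcalc W mu). *)
Definition overlap n (U W : 'M[C]_n) i j : R := sqnorm ((U *m adjmx W) i j).

Lemma overlap_ge0 n (U W : 'M[C]_n) i j : 0 <= overlap U W i j.
Proof. exact: sqnorm_ge0. Qed.

Lemma mxtrace_fcalc_mul n (U : 'M[C]_n) d (X : 'M[C]_n) :
  Re (\tr (fcalc U d *m X)) = \sum_i d i * Re ((U *m X *m adjmx U) i i).
Proof.
rewrite !fcalcE -!mulmxA mxtrace_mulC -!mulmxA /mxtrace Re_sum.
by apply: eq_bigr => i _; rewrite mul_diagCl Re_mulr.
Qed.

(** Inserting adj(W) W = 1 between X and its adjoint expands the trace in two bases at once. *)
Lemma mxtrace_fcalc_gram n (U W X : 'M[C]_n) d : unitary W ->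
  Re (\tr (fcalc U d *m (X *m adjmx X)))
  = \sum_i \sum_j d i * sqnorm ((U *m X *m adjmx W) i j).
Proof.
move=> hW; rewrite mxtrace_fcalc_mul; apply: eq_bigr => i _; rewrite -mulr_sumr.
have -> : U *m (X *m adjmx X) *m adjmx U
    = (U *m X *m adjmx W) *m adjmx (U *m X *m adjmx W).
  rewrite !adjmxM adjmxK !mulmxA -(mulmxA _ (adjmx W) W) (unitaryV hW) mulmx1.
  exact.
rewrite mxE Re_sum; congr (_ * _).
by apply: eq_bigr => j _; rewrite adjmxE -sqnormE.
Qed.

Lemma sum_overlap n (U W : 'M[C]_n) d : unitary U -> unitary W ->
  \sum_i \sum_j d i * overlap U W i j = \sum_i d i.
Proof.
move=> hU hW; have := mxtrace_fcalc_gram U 1%:M d hW.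
rewrite mulmx1 => <-; rewrite mxtrace_fcalc_mul; apply: eq_bigr => i _.
by rewrite adjmx1 !mulmx1 hU mxE eqxx mulr1.
Qed.

Lemma fcalc_overlap n (U W : 'M[C]_n) e i :
  Re ((U *m fcalc W e *m adjmx U) i i) = \sum_j e j * overlap U W i j.
Proof.
have -> : U *m fcalc W e *m adjmx U
    = (U *m adjmx W *m diagC e) *m adjmx (U *m adjmx W).
  by rewrite !fcalcE adjmxM adjmxK !mulmxA.
rewrite mxE Re_sum; apply: eq_bigr => j _.
by rewrite mul_diagCr adjmxE mulrAC -sqnormE -rmorphM /= mulrC.
Qed.

Lemma mxtrace_fcalc2 n (U W : 'M[C]_n) d e :
  Re (\tr (fcalc U d *m fcalc W e)) = \sum_i \sum_j d i * e j * overlap U W i j.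
Proof.
rewrite mxtrace_fcalc_mul; apply: eq_bigr => i _.
by rewrite fcalc_overlap mulr_sumr; apply: eq_bigr => j _; rewrite mulrA.
Qed.

Lemma Re_mul_conj_le (z w : C) (t : R) : 0 < t ->
  Re (z * Num.conj w) <= (t * sqnorm w + sqnorm z / t) / 2.
Proof.
case: z w => [a b] [c d] ht; rewrite /sqnorm; simpc => /=.
rewrite -subr_ge0.
have -> : (t * (c ^+ 2 + d ^+ 2) + (a ^+ 2 + b ^+ 2) / t) / 2 - (a * c + b * d)
   = ((t * c - a) ^+ 2 + (t * d - b) ^+ 2) / (2 * t) by field; lra.
by rewrite divr_ge0 ?addr_ge0 ?sqr_ge0 // mulr_ge0 // ltW.
Qed.

(** With B_ij the squared matrix elements of T, the bad pairs leave a term (sum of lam_i B_ij) / 2,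
    which is at most half of the left-hand side; absorbing it doubles all other terms. On the
    remaining pairs lam_i <= E mu_j lets B be charged to [fcalc W mu]. *)
Lemma test_converse n (U W T : 'M[C]_n) (lam mu : 'I_n -> R) (E t : R) :
  unitary U -> unitary W -> (forall i, 0 <= lam i) -> \sum_i lam i = 1 ->
  (forall j, 0 <= mu j) -> test_op T -> 0 <= E -> 0 < t ->
  Re (\tr (fcalc U lam *m T)) <=
    \sum_i \sum_(j | E * mu j < lam i) lam i * overlap U W i j
    + t + E * Re (\tr (fcalc W mu *m T)) / t.
Proof.
move=> hU hW hl hl1 hm hT hE ht.
have hTa : adjmx T = T by apply: psd_adj; case: hT.
set p := Re _; set s := Re (\tr (fcalc W mu *m T)).
pose B i j := sqnorm ((U *m T *m adjmx W) i j).
have hB0 i j : 0 <= B i j by apply: sqnorm_ge0.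
have hpB : \sum_i \sum_j lam i * B i j <= p.
  rewrite /B -(mxtrace_fcalc_gram U T lam hW) hTa.
  apply: (mxtrace_test_sq _ hT); exact: psd_fcalc.
have hsB : \sum_i \sum_j mu j * B i j <= s.
  rewrite exchange_big /=.
  have -> : \sum_j \sum_i mu j * B i j
          = \sum_j \sum_i mu j * sqnorm ((W *m T *m adjmx U) j i).
    apply: eq_bigr => j _; apply: eq_bigr => i _; congr (_ * _).
    rewrite /B -sqnorm_conj -adjmxE; congr (sqnorm (_ j i)).
    by rewrite !adjmxM adjmxK hTa mulmxA.
  rewrite -(mxtrace_fcalc_gram W T mu hU) hTa.
  apply: (mxtrace_test_sq _ hT); exact: psd_fcalc.
have hp : p = \sum_i \sum_j lam i * Re ((U *m T *m adjmx W) i j *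
                                         Num.conj ((U *m adjmx W) i j)).
  rewrite /p mxtrace_fcalc_mul; apply: eq_bigr => i _.
  have -> : U *m T *m adjmx U = (U *m T *m adjmx W) *m adjmx (U *m adjmx W).
    rewrite adjmxM adjmxK !mulmxA -(mulmxA _ (adjmx W) W) (unitaryV hW) mulmx1.
    exact.
  rewrite mxE Re_sum mulr_sumr; apply: eq_bigr => j _.
  by rewrite adjmxE.
pose bad i j := E * mu j < lam i.
pose pB := \sum_i \sum_(j | bad i j) lam i * overlap U W i j.
(* AM-GM with weight 1 on the bad pairs and t on the others *)
have key : p <= \sum_i \sum_j ((if bad i j then lam i * overlap U W i j else 0) / 2
   + lam i * B i j / 2 + t / 2 * (lam i * overlap U W i j) + E / (2 * t) * (mu j * B i j)).
  rewrite {1}hp; apply: ler_sum => i _; apply: ler_sum => j _.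
  have ho := overlap_ge0 U W i j.
  case: ifP => hb.
    have h := @Re_mul_conj_le ((U *m T *m adjmx W) i j) ((U *m adjmx W) i j) 1 ltr01.
    rewrite divr1 mul1r -/(B i j) -/(overlap U W i j) in h.
    have h1 := ler_wpM2l (hl i) h.
    have h2 : 0 <= t / 2 * (lam i * overlap U W i j).
      by rewrite mulr_ge0 ?divr_ge0 // ?mulr_ge0 // ltW.
    have h3 : 0 <= E / (2 * t) * (mu j * B i j).
      by rewrite mulr_ge0 ?divr_ge0 // ?mulr_ge0 // ltW.
    by clear - h1 h2 h3; lra.
  have h := @Re_mul_conj_le ((U *m T *m adjmx W) i j) ((U *m adjmx W) i j) t ht.
  rewrite -/(B i j) -/(overlap U W i j) in h.
  have h1 := ler_wpM2l (hl i) h.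
  have h2 : 0 <= lam i * B i j / 2 by rewrite divr_ge0 // mulr_ge0.
  have h3 : lam i * (B i j / t) <= E * mu j * (B i j / t).
    apply: ler_wpM2r; first by rewrite divr_ge0 // ltW.
    by move/negbT: hb; rewrite /bad -leNgt.
  have h4 : E / (2 * t) * (mu j * B i j) = E * mu j * (B i j / t) / 2.
    by field; lra.
  by rewrite h4; move: h1 h2 h3; lra.
have e4 : p <= pB / 2 + (\sum_i \sum_j lam i * B i j) / 2 + t / 2
   + E / (2 * t) * (\sum_i \sum_j mu j * B i j).
  apply: (le_trans key); rewrite le_eqVlt; apply/orP; left; apply/eqP.
  have ho : \sum_i \sum_j t / 2 * (lam i * overlap U W i j) = t / 2.
    rewrite -[RHS]mulr1 -hl1 -(sum_overlap lam hU hW) mulr_sumr.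
    by apply: eq_bigr => i _; rewrite mulr_sumr.
  rewrite -[X in _ = _ + X + _]ho /pB !mulr_suml !mulr_sumr -!big_split /=.
  apply: eq_bigr => i _; rewrite !mulr_suml !mulr_sumr [\sum_(j | bad i j) _]big_mkcond -!big_split /=.
  apply: eq_bigr => j _; case: (bad i j); by rewrite ?mul0r.
have h5 : E / (2 * t) * (\sum_i \sum_j mu j * B i j) <= E / (2 * t) * s.
  by apply: ler_wpM2l => //; rewrite divr_ge0 // mulr_ge0 // ltW.
have h6 : E * s / t = 2 * (E / (2 * t) * s) by field; lra.
rewrite h6 -/pB.
move: e4 h5 hpB; lra.
Qed.

Lemma qform_trace n (M : 'M[C]_n) (x : 'cV[C]_n) :
  \tr (M *m (x *m adjmx x)) = (adjmx x *m M *m x) 0 0.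
Proof. by rewrite mulmxA mxtrace_mulC mulmxA /mxtrace big_ord1. Qed.

Lemma qform1 n (x : 'cV[C]_n) :
  adjmx x *m x = ((\sum_i sqnorm (x i 0))%:C)%:M.
Proof.
apply/matrixP => i j; rewrite !ord1 !mxE eqxx mulr1n real_complex_sum.
by apply: eq_bigr => k _; rewrite adjmxE mulrC sqnormE.
Qed.

Definition vnorm2 n (x : 'cV[C]_n) : R := \sum_i sqnorm (x i 0).

Lemma vnorm2_ge0 n (x : 'cV[C]_n) : 0 <= vnorm2 x.
Proof. by apply: sumr_ge0 => i _; apply: sqnorm_ge0. Qed.

Lemma vnorm2_eq0 n (x : 'cV[C]_n) : vnorm2 x = 0 -> x = 0.
Proof.
move=> h; apply/colP => i; rewrite mxE; apply/eqP; rewrite -sqnorm_eq0.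
move/eqP: h; rewrite /vnorm2 psumr_eq0 => [/allP/(_ i (mem_index_enum _))/=//|].
by move=> j _; apply: sqnorm_ge0.
Qed.

(* The Gram-Schmidt step: T' projects onto the range of T extended by xi. *)
Lemma proj_extend n (T : 'M[C]_n) (xi : 'cV[C]_n) :
  adjmx T = T -> T *m T = T ->
  exists T' : 'M[C]_n, [/\ adjmx T' = T', T' *m T' = T', T' *m xi = xi,
    forall y : 'cV[C]_n, T *m y = y -> T' *m y = y &
    exists (eta : 'cV[C]_n) (c : R), [/\ 0 <= c, c * vnorm2 eta <= 1,
       eta = (1%:M - T) *m xi & T' = T + c%:C *: (eta *m adjmx eta)]].
Proof.
move=> hTa hTT; pose eta := (1%:M - T) *m xi.
have hTeta : T *m eta = 0 by rewrite mulmxA mulmxBr mulmx1 hTT subrr mul0mx.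
have hetaT : adjmx eta *m T = 0.
  by rewrite -hTa -adjmxM hTeta; apply/matrixP => i j; rewrite adjmxE !mxE rmorph0.
have hxi : adjmx eta *m xi = adjmx eta *m eta.
  by rewrite {3}/eta mulmxBl mul1mx mulmxBr mulmxA hetaT mul0mx subr0.
have hn := qform1 eta; rewrite -/(vnorm2 eta) in hn.
pose c := (vnorm2 eta)^-1.
(* If xi already lies in the range of T, the projection is unchanged and c = 0 keeps the rank-one
   formula valid. *)
have [h0|h0] := eqVneq (vnorm2 eta) 0.
  have eta0 := vnorm2_eq0 h0.
  exists T; split => //.
    by apply/esym/eqP; rewrite -subr_eq0 -{1}[xi]mul1mx -mulmxBl -/eta eta0.
  exists eta, 0; split => //; first by rewrite mul0r ler01.
  by rewrite (_ : (0 : R)%:C = 0) // scale0r addr0.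
have hc : 0 <= c by rewrite invr_ge0 vnorm2_ge0.
have hP : (eta *m adjmx eta) *m (eta *m adjmx eta) = (vnorm2 eta)%:C *: (eta *m adjmx eta).
  by rewrite mulmxA -(mulmxA eta) hn mul_mx_scalar scalemxAl.
exists (T + c%:C *: (eta *m adjmx eta)); split.
- by rewrite adjmxD adjmxZ hTa adjmxM adjmxK.
- rewrite mulmxDl !mulmxDr hTT -!scalemxAr -!scalemxAl mulmxA hTeta mul0mx.
  rewrite -mulmxA hetaT mulmx0 !scaler0 addr0 add0r hP !scalerA -!rmorphM.
  by rewrite -mulrA mulVf // mulr1.
- rewrite mulmxDl -scalemxAl -mulmxA hxi hn mul_mx_scalar scalerA -rmorphM.
  by rewrite mulVf // scale1r /eta mulmxBl mul1mx addrC subrK.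
- move=> y hy; rewrite mulmxDl hy -{2}hy -scalemxAl -mulmxA (mulmxA (adjmx eta)).
  by rewrite hetaT mul0mx mulmx0 scaler0 addr0.
- by exists eta, c; split => //; rewrite mulVf.
Qed.

End HypothesisTesting.

(** * The Gram-Schmidt test *)

Section LiTest.
Variable R : realType.
Local Notation C := R[i].
Local Notation Re := complex.Re.
Local Open Scope complex_scope.

(** For E > 0, the spectral projection of [fcalc W w] onto eigenvalues at most l / E; it increases
    with l. *)
Definition below n (W : 'M[C]_n) (w : 'I_n -> R) (E l : R) : 'M[C]_n :=
  fcalc W (fun j => if E * w j <= l then 1 else 0).

Lemma below_mul n (W : 'M[C]_n) w E l l' : unitary W -> l <= l' ->
  below W w E l' *m below W w E l = below W w E l.
Proof.
move=> hW hl; rewrite /below (fcalcM _ _ hW); congr fcalc; apply/funext => j.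
case: (lerP (E * w j) l) => h; last by rewrite mulr0.
by rewrite (le_trans h hl) mulr1.
Qed.

(** Compressed to the cut-off subspace, E times the operator is at most l times the identity. *)
Lemma below_weight n (W : 'M[C]_n) w E l (x : 'cV[C]_n) : unitary W -> 0 < E -> 0 <= l ->
  below W w E l *m x = x ->
  E * Re ((adjmx x *m fcalc W w *m x) 0 0) <= l * vnorm2 x.
Proof.
move=> hW hE hl hx; set Q := below W w E l in hx.
have hQ : adjmx Q = Q by apply: adjmx_fcalc.
have sandwich (A F : 'M[C]_n) : adjmx A = A -> A *m x = x ->
    adjmx x *m F *m x = adjmx x *m (A *m F *m A) *m x.
  by move=> hA hAx; rewrite !mulmxA -(mulmxA _ A x) hAx -[in RHS]hA -adjmxM hAx.
rewrite (sandwich _ (fcalc W w) hQ hx).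
have -> : Q *m fcalc W w *m Q = fcalc W (fun j => (if E * w j <= l then 1 else 0) * w j).
  rewrite /Q /below !(fcalcM _ _ hW); congr fcalc; apply/funext => j.
  by case: (_ <= _); rewrite ?mul0r ?mulr0 ?mul1r ?mulr1.
have hpsd : psd (fcalc W (fun j => l * 1 - E * ((if E * w j <= l then 1 else 0) * w j))).
  apply: psd_fcalc => j; case: (lerP (E * w j) l) => h.
    by rewrite mul1r mulr1 subr_ge0.
  by rewrite mul0r mulr0 subr0 mulr1.
have h := hpsd (adjmx x); rewrite -/(adjmx (adjmx x)) adjmxK in h.
have := h; rewrite -fcalcB mulmxBr mulmxBl.
have fcZ c f : fcalc W (fun j => c * f j) = c%:C *: fcalc W f.
  rewrite !fcalcE scalemxAl scalemxAr; congr (_ *m _ *m _).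
  by apply/matrixP => i j; rewrite !mxE mulrnAr -rmorphM.
rewrite !fcZ (fcalc1 hW) -!scalemxAr -!scalemxAl mulmx1 qform1 -/(vnorm2 x).
have hZ (A : 'M[C]_1) (k : C) : (k *: A) 0 0 = k * A 0 0 by rewrite mxE.
have hB (A B : 'M[C]_1) : (A - B) 0 0 = A 0 0 - B 0 0 by rewrite !mxE.
rewrite hB !hZ lecE => /andP[_]; rewrite ReB !Re_mulr [X in l * Re X]mxE eqxx mulr1n /=.
by rewrite subr_ge0.
Qed.

(* The indices in s are processed from the last one on, i.e. by increasing lam, so that the
   cut-off subspaces containing the vectors already used are nested. *)
Lemma li_projection n (U W : 'M[C]_n) (lam w : 'I_n -> R) E (s : seq 'I_n)
    (xi := fun i => below W w E (lam i) *m adjmx (row i U)) :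
  unitary W -> (forall i, 0 <= lam i) -> 0 < E ->
  sorted (fun i j => lam j <= lam i) s ->
  exists T : 'M[C]_n, [/\ adjmx T = T, T *m T = T,
    forall l, all (fun k => lam k <= l) s -> below W w E l *m T = T,
    {in s, forall k, T *m xi k = xi k} &
    E * Re (\tr (fcalc W w *m T)) <= \sum_(k <- s) lam k].
Proof.
move=> hW hl hE; elim: s => [|i s IH].
  move=> _; exists 0; split => //.
  - by apply/matrixP => i j; rewrite adjmxE !mxE rmorph0.
  - by rewrite mulmx0.
  - by move=> l _; rewrite mulmx0.
  - by rewrite mulmx0 linear0 mulr0 big_nil.
move=> /= hsort; have [T [hTa hTT hQ hxi htr]] := IH (path_sorted hsort).
have htrans : transitive (fun i j : 'I_n => lam j <= lam i).
  by move=> y x z hxy hyz; exact: le_trans hyz hxy.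
have hall : all (fun k => lam k <= lam i) s by exact: order_path_min htrans hsort.
have [T' [hTa' hTT' hxi' hT' [eta [c [hc hc1 heta hT'E]]]]] :=
  proj_extend (xi i) hTa hTT.
(* Both xi_i and T xi_i lie in the cut-off subspace of level l, since l dominates lam_i and every
   earlier eigenvalue. *)
have hQeta l : all (fun k => lam k <= l) s -> lam i <= l -> below W w E l *m eta = eta.
  move=> hal hil; rewrite heta mulmxBl mul1mx mulmxBr {1}/xi !mulmxA hQ //.
  by rewrite below_mul.
exists T'; split => //.
- move=> l /= /andP[hil hal]; rewrite hT'E mulmxDr hQ // -scalemxAr mulmxA hQeta //.
- by move=> k; rewrite inE => /predU1P[->//|hk]; apply: hT'; apply: hxi.
rewrite big_cons hT'E mulmxDr linearD /= ReD mulrDr addrC; apply: lerD => //.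
rewrite -scalemxAr linearZ /= Re_mulr qform_trace.
(* The normalised new direction lies in the cut-off subspace of level lam_i, so it adds at most
   lam_i to E tr([fcalc W w] T). *)
have hb := below_weight hW hE (hl i) (hQeta _ hall (lexx _)).
rewrite mulrCA; apply: (le_trans (ler_wpM2l hc hb)).
by rewrite mulrCA -[leRHS]mulr1; apply: ler_wpM2l.
Qed.

Lemma qform_row n (U X : 'M[C]_n) i :
  (U *m X *m adjmx U) i i = (adjmx (adjmx (row i U)) *m X *m adjmx (row i U)) 0 0.
Proof.
rewrite adjmxK !mxE; apply: eq_bigr => k _; rewrite !adjmxE !mxE; congr (_ * _).
by apply: eq_bigr => l _; rewrite !mxE.
Qed.

(** T is the projection onto the span of the truncated vectors Q_i x_i. Since T fixes Q_i x_i, the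
    difference of the quadratic forms of T and Q_i at x_i is the squared norm of T x_i - Q_i x_i,
    hence nonnegative. *)
Lemma test_achievability n (U W : 'M[C]_n) (lam w : 'I_n -> R) E :
  unitary U -> unitary W -> (forall i, 0 <= lam i) -> 0 < E ->
  exists T : 'M[C]_n, [/\ test_op T,
    \sum_i \sum_(j | E * w j <= lam i) lam i * overlap U W i j
      <= Re (\tr (fcalc U lam *m T)) &
    E * Re (\tr (fcalc W w *m T)) <= \sum_i lam i].
Proof.
move=> hU hW hl hE; pose le := fun i j : 'I_n => lam j <= lam i.
have hsort : sorted le (sort le (index_enum 'I_n)).
  by apply: sort_sorted => i j; apply: le_total.
have [T [hTa hTT _ hxi htr]] := li_projection U w hW hl hE hsort.
exists T; split; first exact: test_op_proj.
  rewrite mxtrace_fcalc_mul; apply: ler_sum => i _.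
  rewrite -mulr_sumr; apply: ler_wpM2l => //.
  have {}hxi := hxi i; rewrite mem_sort mem_index_enum in hxi.
  move: {hxi}(hxi isT); set Q := below _ _ _ _; set x := adjmx (row i U).
  move=> hxi.
  have hQa : adjmx Q = Q by apply: adjmx_fcalc.
  have hQQ : Q *m Q = Q by apply: below_mul.
  rewrite qform_row -/x.
  have -> : \sum_(j | E * w j <= lam i) overlap U W i j = Re ((adjmx x *m Q *m x) 0 0).
    rewrite /x -qform_row fcalc_overlap big_mkcond; apply: eq_bigr => j _.
    by case: ifP; rewrite ?mul1r ?mul0r.
  have h : adjmx (T *m x - Q *m x) *m (T *m x - Q *m x)
       = adjmx x *m T *m x - adjmx x *m Q *m x.
    rewrite adjmxB !adjmxM hTa hQa mulmxBr !mulmxBl -!mulmxA (mulmxA T T) hTT.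
    rewrite (mulmxA Q Q) hQQ hxi.
    have -> : adjmx x *m (Q *m (T *m x)) = adjmx (T *m (Q *m x)) *m x.
      by rewrite !adjmxM hTa hQa !mulmxA.
    by rewrite hxi adjmxM hQa -mulmxA opprB addrA subrK.
  have hB (A B : 'M[C]_1) : (A - B) 0 0 = A 0 0 - B 0 0 by rewrite !mxE.
  rewrite -subr_ge0 -ReB -hB -h qform1 mxE eqxx mulr1n; exact: vnorm2_ge0.
by rewrite (perm_big (sort le (index_enum 'I_n))) //= perm_sym perm_sort.
Qed.
End LiTest.

(** * Tensor powers *)

Section TensorPower.
Variable R : realType.
Local Notation C := R[i].
Local Notation Re := complex.Re.
Local Open Scope complex_scope.

(** The quotients by d^(n - m) are shown equal by induction on m: leading digits are compared first,
    starting from the quotient 0. *)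
Lemma digit_inj d n (i j : 'I_(d ^ n)) : (forall k, digit i k = digit j k) -> i = j.
Proof.
move=> h; apply/val_inj => /=.
suff H m : (m <= n)%N -> (i %/ d ^ (n - m) = j %/ d ^ (n - m))%N.
  by have := H n (leqnn n); rewrite subnn expn0 !divn1.
elim: m => [_|m IH hm]; first by rewrite subn0 !divn_small.
have hk : (n - m.+1 < n)%N by rewrite ltn_subrL /= (leq_trans _ hm).
have e : (n - m = (n - m.+1).+1)%N by rewrite subnS prednK // subn_gt0.
have := congr1 val (h (Ordinal hk)) => /= hd.
have := IH (ltnW hm); rewrite e expnSr !divnMA => hq.
by rewrite (divn_eq (i %/ d ^ (n - m.+1)) d) (divn_eq (j %/ d ^ (n - m.+1)) d) hd hq.
Qed.

(** The only property of an indexing by digits that powers rely on; it lets [tpow] and [tpowAB] be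
    treated together as instances of [gpow]. *)
Definition digits_bij N D n (dg : 'I_N -> 'I_n -> 'I_D) :=
  bijective (fun i => [ffun k => dg i k]).

Lemma digit_bij d n : digits_bij (@digit d n).
Proof.
apply: inj_card_bij.
  by move=> i j /ffunP h; apply: digit_inj => k; have := h k; rewrite !ffunE.
by rewrite card_ffun !card_ord.
Qed.

Definition digitAB dA dB n (i : 'I_(dA ^ n * dB ^ n)) (k : 'I_n) : 'I_(dA * dB) :=
  mxtens_index (digit (mxtens_unindex i).1 k, digit (mxtens_unindex i).2 k).

Lemma digitAB_bij dA dB n : digits_bij (@digitAB dA dB n).
Proof.
apply: inj_card_bij; last by rewrite card_ffun !card_ord expnMn.
move=> i j /ffunP h; rewrite -(mxtens_unindexK i) -(mxtens_unindexK j).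
have hk k : digitAB i k = digitAB j k by have := h k; rewrite !ffunE.
congr mxtens_index; rewrite [LHS]surjective_pairing [RHS]surjective_pairing.
by congr pair; apply: digit_inj => k;
  have /(can_inj (@mxtens_indexK _ _)) [h1 h2] := hk k; apply/val_inj.
Qed.

Section GenericPower.
Variables (N D n : nat) (dg : 'I_N -> 'I_n -> 'I_D).

Definition gpow (M : 'M[C]_D) : 'M[C]_N :=
  \matrix_(i, j) \prod_(k < n) M (dg i k) (dg j k).

Hypothesis hdg : digits_bij dg.

Lemma sum_digits (S : comNzRingType) (F : 'I_n -> 'I_D -> S) :
  \sum_i \prod_k F k (dg i k) = \prod_k \sum_x F k x.
Proof.
rewrite bigA_distr_bigA (reindex _ (onW_bij _ hdg)) /=.
by apply: eq_bigr => i _; apply: eq_bigr => k _; rewrite ffunE.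
Qed.

Lemma gpowM (M M' : 'M[C]_D) : gpow (M *m M') = gpow M *m gpow M'.
Proof.
apply/matrixP => i j; rewrite !mxE.
under eq_bigr do rewrite mxE.
rewrite -(sum_digits (fun k x => M (dg i k) x * M' x (dg j k))).
by apply: eq_bigr => l _; rewrite !mxE big_split.
Qed.

Lemma gpow_adj (M : 'M[C]_D) : gpow (adjmx M) = adjmx (gpow M).
Proof.
apply/matrixP => i j; rewrite adjmxE !mxE rmorph_prod.
by apply: eq_bigr => k _; rewrite adjmxE.
Qed.

Lemma mxtrace_gpow (M : 'M[C]_D) : \tr (gpow M) = (\tr M) ^+ n.
Proof.
rewrite /mxtrace; under eq_bigr do rewrite mxE.
by rewrite (sum_digits (fun _ x => M x x)) prodr_const card_ord.
Qed.

Lemma gpow_diagC (d : 'I_D -> R) : gpow (diagC d) = diagC (fun i => \prod_k d (dg i k)).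
Proof.
apply/matrixP => i j; rewrite !mxE.
have [->|nij] := eqVneq i j.
  by rewrite mulr1n rmorph_prod; apply: eq_bigr => k _; rewrite !mxE eqxx mulr1n.
have [k hk] : exists k, dg i k != dg j k.
  apply/existsP; rewrite -negb_forall; apply: contra nij => /forallP h.
  by apply/eqP/(bij_inj hdg)/ffunP => k; rewrite !ffunE; apply/eqP.
by rewrite mulr0n (bigD1 k) //= !mxE (negbTE hk) mulr0n mul0r.
Qed.

Lemma gpow1 : gpow 1%:M = 1%:M.
Proof.
have h1 m : 1%:M = diagC (fun=> 1) :> 'M[C]_m by apply/matrixP => i j; rewrite !mxE.
by rewrite !h1 gpow_diagC; congr diagC; apply/funext => i; rewrite big1.
Qed.

Lemma gpow_unitary (U : 'M[C]_D) : unitary U -> unitary (gpow U).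
Proof. by rewrite /unitary -gpow_adj -gpowM => ->; exact: gpow1. Qed.

Lemma gpow_fcalc (U : 'M[C]_D) d :
  gpow (fcalc U d) = fcalc (gpow U) (fun i => \prod_k d (dg i k)).
Proof. by rewrite !fcalcE !gpowM gpow_adj gpow_diagC. Qed.

Lemma psd_gpow (M : 'M[C]_D) : psd M -> psd (gpow M).
Proof. by move=> /psd_gramP[X ->]; rewrite gpowM gpow_adj; apply: psd_gram. Qed.

Lemma density_gpow (M : 'M[C]_D) : density M -> density (gpow M).
Proof.
by move=> [h1 h2]; split; [apply: psd_gpow | rewrite mxtrace_gpow h2 expr1n].
Qed.

End GenericPower.

Lemma tpowAB_tens dA dB n (M : 'M[C]_dA) (N : 'M[C]_dB) :
  tpowAB n (M *t N) = tpow n M *t tpow n N.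
Proof.
apply/matrixP => i j; rewrite !mxE -big_split /=.
by apply: eq_bigr => k _; rewrite tensmxE.
Qed.

Lemma ptraceB_tpowAB dA dB n (M : 'M[C]_(dA * dB)) :
  ptraceB (tpowAB n M) = tpow n (ptraceB M).
Proof.
apply/matrixP => i j; rewrite !mxE; under [RHS]eq_bigr do rewrite mxE.
rewrite -(sum_digits (@digit_bij dB n)
  (fun k x => M (mxtens_index (digit i k, x)) (mxtens_index (digit j k, x)))).
by apply: eq_bigr => b _; rewrite mxE !mxtens_indexK.
Qed.

Lemma ptraceA_tpowAB dA dB n (M : 'M[C]_(dA * dB)) :
  ptraceA (tpowAB n M) = tpow n (ptraceA M).
Proof.
apply/matrixP => i j; rewrite !mxE; under [RHS]eq_bigr do rewrite mxE.
rewrite -(sum_digits (@digit_bij dA n)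
  (fun k x => M (mxtens_index (x, digit i k)) (mxtens_index (x, digit j k)))).
by apply: eq_bigr => b _; rewrite mxE !mxtens_indexK.
Qed.

(** * Partial traces *)

Lemma sum_tens_index (S : nmodType) m n (F : 'I_(m * n) -> S) :
  \sum_i F i = \sum_a \sum_b F (mxtens_index (a, b)).
Proof.
rewrite pair_bigA /= (reindex (@mxtens_index m n)) /=; last first.
  by apply: onW_bij; exists (@mxtens_unindex m n); [apply: mxtens_indexK | apply: mxtens_unindexK].
by apply: eq_bigr => -[a b] _.
Qed.

(* Partial traces as compressions by 1 (x) <b|, which makes positivity evident. *)
Lemma psd_ptraceB dA dB (M : 'M[C]_(dA * dB)) : psd M -> psd (ptraceB M).
Proof.
move=> /psd_gramP[X ->] v; rewrite -/(adjmx v).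
have -> : v *m ptraceB (X *m adjmx X) *m adjmx v =
   \sum_b (v *m (\matrix_(a, k) X (mxtens_index (a, b)) k)) *m
        adjmx (v *m (\matrix_(a, k) X (mxtens_index (a, b)) k)).
  under eq_bigr do rewrite adjmxM mulmxA -(mulmxA v).
  rewrite -mulmx_suml -mulmx_sumr; congr (_ *m _ *m _).
  apply/matrixP => i j; rewrite mxE summxE; apply: eq_bigr => b _.
  by rewrite !mxE; apply: eq_bigr => k _; rewrite !adjmxE !mxE.
rewrite summxE; apply: sumr_ge0 => b _; rewrite mxE.
by apply: sumr_ge0 => k _; rewrite adjmxE mul_conjC_ge0.
Qed.

Lemma psd_ptraceA dA dB (M : 'M[C]_(dA * dB)) : psd M -> psd (ptraceA M).
Proof.
move=> /psd_gramP[X ->] v; rewrite -/(adjmx v).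
have -> : v *m ptraceA (X *m adjmx X) *m adjmx v =
   \sum_a (v *m (\matrix_(b, k) X (mxtens_index (a, b)) k)) *m
        adjmx (v *m (\matrix_(b, k) X (mxtens_index (a, b)) k)).
  under eq_bigr do rewrite adjmxM mulmxA -(mulmxA v).
  rewrite -mulmx_suml -mulmx_sumr; congr (_ *m _ *m _).
  apply/matrixP => i j; rewrite mxE summxE; apply: eq_bigr => b _.
  by rewrite !mxE; apply: eq_bigr => k _; rewrite !adjmxE !mxE.
rewrite summxE; apply: sumr_ge0 => b _; rewrite mxE.
by apply: sumr_ge0 => k _; rewrite adjmxE mul_conjC_ge0.
Qed.

Lemma mxtrace_ptraceB dA dB (M : 'M[C]_(dA * dB)) : \tr (ptraceB M) = \tr M.
Proof. by rewrite /mxtrace sum_tens_index; apply: eq_bigr => a _; rewrite mxE. Qed.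

Lemma mxtrace_ptraceA dA dB (M : 'M[C]_(dA * dB)) : \tr (ptraceA M) = \tr M.
Proof.
rewrite /mxtrace sum_tens_index exchange_big /=.
by apply: eq_bigr => a _; rewrite mxE.
Qed.

Lemma density_ptraceB dA dB (M : 'M[C]_(dA * dB)) : density M -> density (ptraceB M).
Proof. by move=> [h1 h2]; split; [apply: psd_ptraceB | rewrite mxtrace_ptraceB]. Qed.

Lemma density_ptraceA dA dB (M : 'M[C]_(dA * dB)) : density M -> density (ptraceA M).
Proof. by move=> [h1 h2]; split; [apply: psd_ptraceA | rewrite mxtrace_ptraceA]. Qed.

Lemma mxtrace_ptraceB_mul dA dB (M : 'M[C]_(dA * dB)) (X : 'M[C]_dA) :
  \tr (ptraceB M *m X) = \tr (M *m (X *t 1%:M)).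
Proof.
rewrite /mxtrace sum_tens_index; apply: eq_bigr => a _; rewrite !mxE.
under [RHS]eq_bigr do rewrite mxE sum_tens_index.
rewrite [RHS]exchange_big /=; apply: eq_bigr => a' _.
rewrite mxE mulr_suml; apply: eq_bigr => b _.
rewrite (bigD1 b) //= big1 => [|b' hb]; first by rewrite addr0 tensmxE !mxE eqxx mulr1.
by rewrite tensmxE !mxE (negbTE hb) !mulr0.
Qed.

Lemma mxtrace_ptraceA_mul dA dB (M : 'M[C]_(dA * dB)) (X : 'M[C]_dB) :
  \tr (ptraceA M *m X) = \tr (M *m (1%:M *t X)).
Proof.
rewrite /mxtrace sum_tens_index exchange_big; apply: eq_bigr => b _; rewrite !mxE.
under [RHS]eq_bigr do rewrite mxE sum_tens_index exchange_big /=.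
rewrite [RHS]exchange_big /=; apply: eq_bigr => b' _.
rewrite mxE mulr_suml; apply: eq_bigr => a _.
rewrite (bigD1 a) //= big1 => [|a' ha]; first by rewrite addr0 tensmxE !mxE eqxx mul1r.
by rewrite tensmxE !mxE (negbTE ha) mul0r mulr0.
Qed.

Lemma mxtrace_mul_delta n (M : 'M[C]_n) a : \tr (M *m delta_mx a a) = M a a.
Proof.
rewrite /mxtrace (bigD1 a) //= big1 ?addr0 => [|k hk]; last first.
  by rewrite mxE big1 // => l _; rewrite mxE (negbTE hk) andbF mulr0.
rewrite mxE (bigD1 a) //= big1 ?addr0 => [|k hk]; last first.
  by rewrite mxE (negbTE hk) mulr0.
by rewrite mxE !eqxx mulr1.
Qed.

(** A diagonal entry is a trace against [delta_mx a a]; once this is moved to the full space, the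
    unitary on B cancels by cyclicity. *)
Lemma ptraceB_conj dA dB (M : 'M[C]_(dA * dB)) (U : 'M[C]_dA) (W : 'M[C]_dB) a :
  unitary W ->
  \sum_b ((U *t W) *m M *m adjmx (U *t W)) (mxtens_index (a, b)) (mxtens_index (a, b))
  = (U *m ptraceB M *m adjmx U) a a.
Proof.
move=> hW; set Y := _ *m M *m _; transitivity (ptraceB Y a a); first by rewrite mxE.
rewrite -[LHS]mxtrace_mul_delta -[RHS]mxtrace_mul_delta mxtrace_ptraceB_mul /Y.
rewrite -!mulmxA mxtrace_mulC -!mulmxA [RHS]mxtrace_mulC -!mulmxA mxtrace_ptraceB_mul.
by rewrite adjmx_tens !tensmx_mul mul1mx (unitaryV hW).
Qed.

Lemma ptraceA_conj dA dB (M : 'M[C]_(dA * dB)) (U : 'M[C]_dA) (W : 'M[C]_dB) b :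
  unitary U ->
  \sum_a ((U *t W) *m M *m adjmx (U *t W)) (mxtens_index (a, b)) (mxtens_index (a, b))
  = (W *m ptraceA M *m adjmx W) b b.
Proof.
move=> hU; set Y := _ *m M *m _; transitivity (ptraceA Y b b); first by rewrite mxE.
rewrite -[LHS]mxtrace_mul_delta -[RHS]mxtrace_mul_delta mxtrace_ptraceA_mul /Y.
rewrite -!mulmxA mxtrace_mulC -!mulmxA [RHS]mxtrace_mulC -!mulmxA mxtrace_ptraceA_mul.
by rewrite adjmx_tens !tensmx_mul mul1mx (unitaryV hU).
Qed.
End TensorPower.

(** * The universal symmetric operator *)

Local Notation perm_inv := Defs.perm_inv.

Section Universal.
Variable R : realType.
Local Notation C := R[i].
Local Notation Re := complex.Re.
Local Open Scope complex_scope.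
Variables d n : nat.
Local Notation N := (d ^ n)%N.
Implicit Types (i j : 'I_N) (p : 'S_n).

Lemma act_exists p i : exists i' : 'I_N, forall k, digit i' k = digit i (p k).
Proof.
have [g _ hg] := digit_bij d n; exists (g [ffun k => digit i (p k)]) => k.
by have /ffunP/(_ k) := hg [ffun k => digit i (p k)]; rewrite !ffunE.
Qed.

(** The action of S_n on multi-indices. The witness may be chosen abstractly because its digits
    determine it. *)
Definition act p i : 'I_N := projT1 (cid (act_exists p i)).

Lemma digit_act p i k : digit (act p i) k = digit i (p k).
Proof. by rewrite /act; case: cid. Qed.

Lemma act_bij p : bijective (act p).
Proof.
exists (act p^-1%g) => i; apply: digit_inj => k; rewrite !digit_act.
  by rewrite permKV.
by rewrite permK.
Qed.

Lemma perm_invP (M : 'M[C]_N) :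
  perm_inv M <-> forall p i j, M (act p i) (act p j) = M i j.
Proof.
split=> [h p i j|h p i j i' j' hi hj]; first by apply: (h p) => k; rewrite digit_act.
have -> : i' = act p i by apply: digit_inj => k; rewrite digit_act.
by have -> : j' = act p j by apply: digit_inj => k; rewrite digit_act.
Qed.

Lemma perm_invM (M M' : 'M[C]_N) : perm_inv M -> perm_inv M' -> perm_inv (M *m M').
Proof.
move=> /perm_invP h /perm_invP h'; apply/perm_invP => p i j; rewrite !mxE.
rewrite (reindex _ (onW_bij _ (act_bij p))) /=.
by apply: eq_bigr => l _; rewrite h h'.
Qed.

Lemma perm_inv_adj (M : 'M[C]_N) : perm_inv M -> perm_inv (adjmx M).
Proof.
by move=> /perm_invP h; apply/perm_invP => p i j; rewrite !adjmxE h.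
Qed.

Lemma perm_inv_tpow (M : 'M[C]_d) : perm_inv (tpow n M).
Proof.
apply/perm_invP => p i j; rewrite !mxE [RHS](reindex_inj (@perm_inj _ p)).
by apply: eq_bigr => k _; rewrite !digit_act.
Qed.

(** Permuting the columns of U gives a second diagonalisation of the same invariant matrix, and
    [fcalc_unique] says that f of it does not depend on the diagonalisation. *)
Lemma perm_inv_fcalc (U : 'M[C]_N) e (f : R -> R) : unitary U ->
  perm_inv (fcalc U e) -> perm_inv (fcalc U (f \o e)).
Proof.
move=> hU /perm_invP h; apply/perm_invP => p i j.
pose U' : 'M[C]_N := \matrix_(k, l) U k (act p l).
have hperm g : fcalc U' g = \matrix_(k, l) fcalc U g (act p k) (act p l).
  apply/matrixP => k l; rewrite !fcalcE !mxE; apply: eq_bigr => m _.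
  rewrite !mul_diagCr !adjmxE !mxE; congr (_ * _).
have hU' : unitary U'.
  apply: mulmx1C; have := hperm (fun=> 1); rewrite (fcalc1 hU).
  rewrite fcalcE (_ : diagC _ = 1%:M) ?mulmx1 => [->|]; last first.
    by apply/matrixP => k l; rewrite !mxE.
  apply/matrixP => k l; rewrite !mxE (inj_eq (bij_inj (act_bij p))).
  exact.
have e1 : fcalc U' e = fcalc U e by rewrite hperm; apply/matrixP => k l; rewrite mxE h.
have := fcalc_unique f hU' hU e1.
by move/matrixP/(_ i j); rewrite hperm mxE.
Qed.

(** The joint type of two sequences, which labels the orbits of S_n on index pairs. Counts in
    ['I_n.+1] make the number of types visibly polynomial in n. *)
Definition pair_type i j : {ffun 'I_d * 'I_d -> 'I_n.+1} :=
  [ffun x => inord (count (fun k => (digit i k, digit j k) == x) (enum 'I_n))].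

(** Equal counts mean that the sequences of digit pairs are rearrangements of each other; the
    rearranging permutation acts on both indices simultaneously. *)
Lemma pair_typeP i j i' j' :
  pair_type i j = pair_type i' j' <-> exists p, i' = act p i /\ j' = act p j.
Proof.
have cle P : (count P (enum 'I_n) < n.+1)%N.
  by rewrite ltnS (leq_trans (count_size _ _)) // size_enum_ord.
split=> [/ffunP h|[p [-> ->]]]; last first.
  apply/ffunP => x; rewrite !ffunE; congr inord.
  rewrite -!size_filter -!sum1_size !big_filter !big_enum_cond /=.
  rewrite (reindex_inj (@perm_inj _ p)).
  by apply: eq_bigl => k; rewrite !digit_act.
pose t := [tuple (digit i k, digit j k) | k < n].
pose t' := [tuple (digit i' k, digit j' k) | k < n].
have : perm_eq t' t.
  apply/allP => x _ /=; rewrite !count_map.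
  have e := congr1 (@nat_of_ord _) (h x); rewrite !ffunE !inordK ?cle // in e.
  by rewrite eq_sym; apply/eqP; rewrite enumT in e; exact: e.
case/tuple_permP => p hp; exists p.
have hk k : (digit i' k, digit j' k) = (digit i (p k), digit j (p k)).
  have := congr1 (fun s => tnth s k) (val_inj hp : t' = _).
  by rewrite !tnth_mktuple.
split; apply: digit_inj => k; rewrite digit_act.
  exact: (congr1 fst (hk k)).
exact: (congr1 snd (hk k)).
Qed.

Definition type_card (t : {ffun 'I_d * 'I_d -> 'I_n.+1}) : R :=
  (\sum_i \sum_j (pair_type i j == t))%:R.

(** An orbit indicator scaled to Hilbert-Schmidt norm one; for a type that does not occur it is the
    zero matrix. *)
Definition type_mx t : 'M[C]_N :=
  \matrix_(i, j) ((pair_type i j == t)%:R / Num.sqrt (type_card t))%:C.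

Lemma perm_inv_const (M : 'M[C]_N) i j i' j' : perm_inv M ->
  pair_type i j = pair_type i' j' -> M i j = M i' j'.
Proof. by move=> /perm_invP h /pair_typeP[p [-> ->]]; rewrite h. Qed.

Lemma perm_inv_type_mx t : perm_inv (type_mx t).
Proof.
apply/perm_invP => p i j; rewrite !mxE; congr (_%:R / _)%:C.
suff -> : pair_type (act p i) (act p j) = pair_type i j by [].
by apply/esym/pair_typeP; exists p.
Qed.

Lemma type_card_gt0 i j : 0 < type_card (pair_type i j).
Proof.
rewrite ltr0n (bigD1 i) //= (bigD1 j) //= eqxx; exact: ltn0Sn.
Qed.

(* The normalised type indicators form an orthonormal basis of the commutant. *)
Lemma perm_inv_expand (M : 'M[C]_N) : perm_inv M ->
  M = \sum_t (\tr (adjmx (type_mx t) *m M)) *: type_mx t.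
Proof.
move=> hM; apply/matrixP => i j; rewrite summxE.
set t := pair_type i j; rewrite (bigD1 t) //= big1 ?addr0; last first.
  by move=> t' ht'; rewrite !mxE eq_sym (negbTE ht') mul0r (_ : (0 : R)%:C = 0) // mulr0.
have hc := type_card_gt0 i j; rewrite -/t in hc.
have hs : 0 < Num.sqrt (type_card t) by rewrite sqrtr_gt0.
rewrite !mxE eqxx mul1r /mxtrace.
have -> : \sum_k (adjmx (type_mx t) *m M) k k
  = \sum_k \sum_l ((pair_type k l == t)%:R / Num.sqrt (type_card t))%:C * M i j.
  rewrite exchange_big /=; apply: eq_bigr => l _; rewrite mxE; apply: eq_bigr => k _.
  rewrite adjmxE mxE conjCR; case: eqP => [e|_]; last by rewrite mul0r !mul0r.
  by rewrite (perm_inv_const hM e).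
under eq_bigr do rewrite -mulr_suml -real_complex_sum.
rewrite -mulr_suml -real_complex_sum.
have -> : \sum_k \sum_l (pair_type k l == t)%:R / Num.sqrt (type_card t)
    = Num.sqrt (type_card t).
  under eq_bigr do rewrite -mulr_suml.
  rewrite -mulr_suml.
  have -> : \sum_k \sum_l (pair_type k l == t)%:R = type_card t.
    by rewrite /type_card natr_sum; apply: eq_bigr => k _; rewrite natr_sum.
  rewrite -{1}(@sqr_sqrtr _ (type_card t)) ?(ltW hc) //.
  by rewrite expr2 mulfK // gt_eqF.
rewrite mulrAC -rmorphM /= mulfV ?gt_eqF //.
by rewrite (_ : (1 : R)%:C = 1) // mul1r.
Qed.

(* The universal symmetric state, up to normalisation. *)
Definition universal_mx : 'M[C]_N := \sum_t type_mx t *m adjmx (type_mx t).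

Lemma psd_sum (I : Type) (r : seq I) m (F : I -> 'M[C]_m) :
  (forall k, psd (F k)) -> psd (\sum_(k <- r) F k).
Proof.
by move=> h; elim/big_ind: _ => //; [apply: psd0 | move=> *; apply: psdD].
Qed.

Lemma psd_universal : psd universal_mx.
Proof. by apply: psd_sum => t; apply: psd_gram. Qed.

(** Write E_t for the type matrices. Expanding X E_t over the E_s, and adj(E_s) X over the adj(E_t),
    produces the same coefficients tr(adj(E_s) X E_t), so both products are one double sum in two
    orders. *)
Lemma universal_comm (X : 'M[C]_N) : perm_inv X -> X *m universal_mx = universal_mx *m X.
Proof.
move=> hX; rewrite mulmx_sumr mulmx_suml.
have e1 t : X *m (type_mx t *m adjmx (type_mx t))
  = \sum_s \tr (adjmx (type_mx s) *m X *m type_mx t) *: (type_mx s *m adjmx (type_mx t)).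
  have hXt := perm_invM hX (perm_inv_type_mx t).
  rewrite mulmxA {1}(perm_inv_expand hXt) mulmx_suml; apply: eq_bigr => s _.
  by rewrite -scalemxAl mulmxA.
have e2 s : (type_mx s *m adjmx (type_mx s)) *m X
  = \sum_t \tr (adjmx (type_mx s) *m X *m type_mx t) *: (type_mx s *m adjmx (type_mx t)).
  have hXt := perm_invM (perm_inv_adj hX) (perm_inv_type_mx s).
  rewrite -mulmxA -[adjmx (type_mx s) *m X]adjmxK adjmxM adjmxK.
  rewrite {1}(perm_inv_expand hXt).
  rewrite adjmx_sumZ mulmx_sumr; apply: eq_bigr => t _; rewrite -scalemxAr.
  by rewrite -mxtrace_adj !adjmxM !adjmxK.
under eq_bigr do rewrite e1.
under [RHS]eq_bigr do rewrite e2.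
by rewrite exchange_big.
Qed.

(** Let S be the square root of sigma, with coefficients c_t in the type basis. The squares of |c_t|
    sum to tr sigma = 1, so the difference is the sum of the Gram matrices of E_t - conj(c_t) S. *)
Lemma universal_dominates (sigma : 'M[C]_N) : density sigma -> perm_inv sigma ->
  psd (universal_mx - sigma).
Proof.
move=> [hs htr] hp; have [U [e [hU he hsU]]] := psd_fcalcP hs.
pose S := fcalc U (Num.sqrt \o e).
have hS : perm_inv S by apply: perm_inv_fcalc => //; rewrite -hsU.
have hSa : adjmx S = S by apply: adjmx_fcalc.
have hSS : S *m adjmx S = sigma.
  rewrite hSa /S (fcalcM _ _ hU) hsU; congr fcalc; apply/funext => i /=.
  by rewrite -expr2 sqr_sqrtr.
pose c t := \tr (adjmx (type_mx t) *m S).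
have hSc := perm_inv_expand hS; rewrite -/(c _) in hSc.
have hcc : \sum_t c t * Num.conj (c t) = 1.
  have : \tr (S *m adjmx S) = 1 by rewrite hSS.
  rewrite mxtrace_mulC {1}hSc => <-.
  rewrite adjmx_sumZ mulmx_suml linear_sum; apply: eq_bigr => t _ /=.
  by rewrite -scalemxAl linearZ /= mulrC.
suff -> : universal_mx - sigma = \sum_t (type_mx t - Num.conj (c t) *: S) *m
     adjmx (type_mx t - Num.conj (c t) *: S).
  by apply: psd_sum => t; apply: psd_gram.
have adjZ k (M : 'M[C]_N) : adjmx (k *: M) = Num.conj k *: adjmx M.
  by apply/matrixP => i j; rewrite adjmxE !mxE rmorphM.
under [RHS]eq_bigr => t _.
  rewrite adjmxB adjZ conjCK mulmxBl !mulmxBr -!scalemxAr -!scalemxAl hSS scalerA.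
  over.
rewrite !sumrB /=.
have -> : \sum_t c t *: (type_mx t *m adjmx S) = sigma.
  under eq_bigr do rewrite scalemxAl.
  by rewrite -mulmx_suml -hSc hSS.
have -> : \sum_t Num.conj (c t) *: (S *m adjmx (type_mx t)) = sigma.
  have hSa' : adjmx S = \sum_t Num.conj (c t) *: adjmx (type_mx t).
    by rewrite {1}hSc adjmx_sumZ.
  under eq_bigr do rewrite scalemxAr.
  by rewrite -mulmx_sumr -hSa' hSS.
by rewrite -scaler_suml hcc scale1r subrr subr0.
Qed.

(** Every occurring type contributes exactly one to the trace, so the trace is bounded by the number
    of types. *)
Lemma mxtrace_universal : Re (\tr universal_mx) <= (n.+1 ^ (d * d))%:R.
Proof.
have -> : \tr universal_mx = \sum_t \tr (type_mx t *m adjmx (type_mx t)).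
  by rewrite /universal_mx linear_sum.
rewrite Re_sum.
have -> : (n.+1 ^ (d * d))%:R = \sum_(t : {ffun 'I_d * 'I_d -> 'I_n.+1}) 1 :> R.
  by rewrite sumr_const card_ffun card_prod !card_ord.
apply: ler_sum => t _; rewrite mxtrace_gram /=.
have -> : \sum_i \sum_j sqnorm (type_mx t i j) = type_card t / type_card t.
  rewrite {1}/type_card natr_sum mulr_suml; apply: eq_bigr => i _.
  rewrite natr_sum mulr_suml; apply: eq_bigr => j _.
  rewrite mxE /sqnorm /= expr0n addr0 exprMn exprVn sqr_sqrtr ?ler0n //.
  by case: (_ == _); rewrite ?expr1n ?expr0n.
by have [->|h] := eqVneq (type_card t) 0; rewrite ?mul0r ?mulfV.
Qed.
End Universal.

(** * Moderate deviations from the moment generating function *)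

Section ClassicalModerateDeviations.
Variable R : realType.
Implicit Types (x y u a V : R).

(** The mean value theorem passes the sign of a derivative to the function on either side of 0.
    Applied repeatedly to the Taylor remainders of the exponential, whose sign on the negative axis
    alternates with the degree. *)
Lemma taylor_step (f df : R -> R) : (forall x, is_derive x (1 : R) f (df x)) ->
  f 0 = 0 -> (forall x, 0 <= x -> 0 <= df x) -> (forall x, 0 <= x -> 0 <= f x) /\
  ((forall x, x <= 0 -> 0 <= df x) -> forall x, x <= 0 -> f x <= 0) /\
  ((forall x, x <= 0 -> df x <= 0) -> forall x, x <= 0 -> 0 <= f x).
Proof.
move=> hd f0 hpos.
have hc a b : {within `[a, b], continuous f}.
  by apply: derivable_within_continuous => x _; exact: ex_derive.
split; [|split] => [x hx|hneg x hx|hneg x hx].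
- have [c hc1 e] := MVT_segment hx (fun y _ => hd y) (hc _ _).
  rewrite f0 !subr0 in e; rewrite e mulr_ge0 // hpos //.
  by move: hc1; rewrite in_itv /= => /andP[].
- have [c hc1 e] := MVT_segment hx (fun y _ => hd y) (hc _ _).
  rewrite f0 !sub0r in e; rewrite -oppr_ge0 e mulr_ge0 ?oppr_ge0 // hneg //.
  by move: hc1; rewrite in_itv /= => /andP[].
- have [c hc1 e] := MVT_segment hx (fun y _ => hd y) (hc _ _).
  rewrite f0 !sub0r in e; rewrite -oppr_le0 e mulr_le0_ge0 ?oppr_ge0 // hneg //.
  by move: hc1; rewrite in_itv /= => /andP[].
Qed.

Lemma is_derive_expR_deg2 x : is_derive x (1 : R)
  (fun y => expR y - (1 + y + y ^+ 2 / 2)) (expR x - (1 + x)).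
Proof.
have -> : (fun y => expR y - (1 + y + y ^+ 2 / 2)) =
   (expR - (cst 1 + id + 2^-1 \*: (id ^+ 2))) :> (R -> R).
  by apply/funext => y /=; rewrite !fctE /= /GRing.scale /= mulrC.
apply: is_derive_eq; rewrite /= /GRing.scale /=; lra.
Qed.

Lemma is_derive_expR_deg3 x : is_derive x (1 : R)
  (fun y => expR y - (1 + y + y ^+ 2 / 2 + y ^+ 3 / 6)) (expR x - (1 + x + x ^+ 2 / 2)).
Proof.
have -> : (fun y => expR y - (1 + y + y ^+ 2 / 2 + y ^+ 3 / 6)) =
   (expR - (cst 1 + id + 2^-1 \*: (id ^+ 2) + 6^-1 \*: (id ^+ 3))) :> (R -> R).
  by apply/funext => y /=; rewrite !fctE /= /GRing.scale /= ![_ * _^-1]mulrC.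
apply: is_derive_eq; rewrite /= /GRing.scale /=; lra.
Qed.
Lemma expR_ge_deg3 x : 1 + x + x ^+ 2 / 2 + x ^+ 3 / 6 <= expR x.
Proof.
have e1 y : 0 <= expR y - (1 + y) by rewrite subr_ge0 expR_ge1Dx.
have z2 : expR 0 - (1 + 0 + 0 ^+ 2 / 2) = 0 :> R by rewrite expR0 expr0n /=; lra.
have z3 : expR 0 - (1 + 0 + 0 ^+ 2 / 2 + 0 ^+ 3 / 6) = 0 :> R.
  by rewrite expR0 !expr0n /=; lra.
have [h1 [h2 _]] := taylor_step is_derive_expR_deg2 z2 (fun y _ => e1 y).
have {}h2 := h2 (fun y _ => e1 y).
have [h3 [_ h4]] := taylor_step is_derive_expR_deg3 z3 h1.
have {}h4 := h4 h2.
by rewrite -subr_ge0; have [x0|/ltW x0] := lerP 0 x; [apply: h3|apply: h4].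
Qed.

(** Inverts the cubic lower bound at -x. The product of the claimed bound with that cubic exceeds 1
    by |x|^3 times a factor that is nonnegative for |x| <= 1. *)
Lemma expR_le_deg2 x : `|x| <= 1 -> expR x <= 1 + x + x ^+ 2 / 2 + `|x| ^+ 3.
Proof.
move=> hx; have h := expR_ge_deg3 (- x); rewrite expRN in h.
have hp : 0 < 1 + - x + (- x) ^+ 2 / 2 + (- x) ^+ 3 / 6.
  by move: hx; rewrite ler_norml => /andP[h1 h2]; nra.
have h2 : expR x <= (1 + - x + (- x) ^+ 2 / 2 + (- x) ^+ 3 / 6)^-1.
  by rewrite -[expR x]invrK lef_pV2 // posrE invr_gt0 expR_gt0.
apply: (le_trans h2); rewrite -[leLHS]mul1r ler_pdivrMr // -subr_ge0.
have [x0|x0] := lerP 0 x.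
  rewrite ger0_norm // in hx *.
  have -> : (1 + x + x ^+ 2 / 2 + x ^+ 3) * (1 + - x + (- x) ^+ 2 / 2 + (- x) ^+ 3 / 6) - 1
    = x ^+ 3 * (5 / 6 - 11 / 12 * x + 5 / 12 * x ^+ 2 - x ^+ 3 / 6) by field.
  apply: mulr_ge0; first exact: exprn_ge0.
  have h3 : x ^+ 3 <= x ^+ 2 by rewrite exprS ler_piMl // exprn_ge0.
  nra.
rewrite ltr0_norm // in hx *.
have -> : (1 + x + x ^+ 2 / 2 + (- x) ^+ 3) * (1 + - x + (- x) ^+ 2 / 2 + (- x) ^+ 3 / 6) - 1
    = (- x) ^+ 3 * (7 / 6 + 13 / 12 * (- x) + 7 / 12 * (- x) ^+ 2 + (- x) ^+ 3 / 6) by field.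
have hx0 : 0 <= - x by lra.
have h2' := exprn_ge0 2 hx0; have h3' := exprn_ge0 3 hx0.
by apply: mulr_ge0; [|lra].
Qed.

Section Mgf.
Variables (I : finType) (q X : I -> R).
Hypotheses (hq : forall i, 0 <= q i) (hq1 : \sum_i q i = 1) (hmean : \sum_i q i * X i = 0).
Definition mgf u : R := \sum_i q i * expR (u * X i).
Definition second_moment : R := \sum_i q i * X i ^+ 2.
Local Notation V := second_moment.

Lemma mgf_bounds : exists C : R, 0 < C /\ forall u, `|u| * C <= 1 ->
  `| mgf u - (1 + u ^+ 2 * V / 2) | <= `|u| ^+ 3 * C.
Proof.
(* B bounds every |X_i| and is at least 1, so |u| B^3 <= 1 forces |u X_i| <= 1, and B^3 also
   controls the cubic error. *)
pose B := 1 + \sum_i `|X i|.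
have hB1 : 1 <= B by rewrite lerDl sumr_ge0.
have hXB i : `|X i| <= B.
  rewrite /B (bigD1 i) //= addrCA lerDl addr_ge0 // sumr_ge0 //.
have hB0 : 0 < B by apply: lt_le_trans hB1.
exists (B ^+ 3); split; first by rewrite exprn_gt0.
move=> u hu.
have hBB : B <= B ^+ 3 by rewrite ler_eXnr.
have -> : 1 + u ^+ 2 * V / 2 = \sum_i q i * (1 + u * X i + (u * X i) ^+ 2 / 2).
  have e i : q i * (1 + u * X i + (u * X i) ^+ 2 / 2)
     = q i + u * (q i * X i) + u ^+ 2 / 2 * (q i * X i ^+ 2) by field.
  under eq_bigr do rewrite e.
  rewrite !big_split /= -!mulr_sumr hq1 hmean mulr0 addr0 /second_moment.
  by congr (_ + _); rewrite mulrAC.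
rewrite /mgf -sumrB; apply: (le_trans (ler_norm_sum _ _ _)).
have -> : `|u| ^+ 3 * B ^+ 3 = \sum_i q i * (`|u| ^+ 3 * B ^+ 3).
  by rewrite -mulr_suml hq1 mul1r.
apply: ler_sum => i _; rewrite -mulrBr normrM ger0_norm //; apply: ler_wpM2l => //.
set x := u * X i.
have hx : `|x| <= 1.
  rewrite normrM; apply: le_trans hu; apply: ler_wpM2l => //.
  exact: le_trans (hXB i) hBB.
have h1 := expR_le_deg2 hx; have h2 := expR_ge_deg3 x.
have h3 : `|x| ^+ 3 <= `|u| ^+ 3 * B ^+ 3.
  have hxB : `|x| <= `|u| * B by rewrite /x normrM; apply: ler_wpM2l.
  by rewrite -exprMn; apply: lerXn2r hxB; rewrite nnegrE ?mulr_ge0 ?(ltW hB0).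
apply: le_trans h3; rewrite ler_norml.
have h4 : - `|x| ^+ 3 <= x ^+ 3 / 6.
  have : `|x ^+ 3| <= `|x| ^+ 3 by rewrite normrX.
  by rewrite ler_norml => /andP[h _]; have := exprn_ge0 3 (normr_ge0 x); lra.
by apply/andP; split; lra.
Qed.

Lemma expR_div_le x : 0 <= x -> expR (x / (1 + x)) <= 1 + x.
Proof.
move=> hx; have h1 : 0 < 1 + x by lra.
have := expR_ge1Dx (- (x / (1 + x))).
have -> : 1 + - (x / (1 + x)) = (1 + x)^-1 by field; lra.
by rewrite expRN lef_pV2 // posrE expR_gt0.
Qed.

(** Puts the quadratic expansion in exponential form, so that n-th powers become multiplication of
    the exponent by n. *)
Lemma mgf_expR_bounds (k : R) : 0 < V -> 0 < k -> exists2 delta : R, 0 < delta &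
  forall u, `|u| < delta ->
   expR (u ^+ 2 * (V / 2 - k)) <= mgf u <= expR (u ^+ 2 * (V / 2 + k)).
Proof.
move=> hV hk; have [C [hC hb]] := mgf_bounds.
(* In order: u^2 <= |u|; validity of [mgf_bounds]; cubic error at most k u^2 / 2; w >= V / 4 below;
   and the loss y^2 in passing from 1 + y to an exponential at most k u^2 / 2. *)
exists (Num.min 1 (Num.min (C^-1) (Num.min (k / (2 * C)) (Num.min (V / (4 * C)) (2 * k / V ^+ 2))))).
  by rewrite !lt_min ltr01 invr_gt0 hC !divr_gt0 ?mulr_gt0 ?exprn_gt0.
move=> u; rewrite !lt_min => /andP[h1 /andP[h2 /andP[h3 /andP[h4 h5]]]].
have hu0 := normr_ge0 u; have hu2 : `|u| ^+ 2 = u ^+ 2 by rewrite real_normK // num_real.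
set r := `|u| in hu0 hu2 h1 h2 h3 h4 h5 *.
have h2' : r * C <= 1 by rewrite -ler_pdivlMr // mul1r ltW.
have h3' : r * C <= k / 2.
  have -> : k / 2 = k / (2 * C) * C by field; lra.
  by rewrite ler_pM2r // ltW.
have h4' : r * C <= V / 4.
  have -> : V / 4 = V / (4 * C) * C by field; lra.
  by rewrite ler_pM2r // ltW.
have h5' : r * V ^+ 2 <= 2 * k by rewrite -ler_pdivlMr ?exprn_gt0 // ltW.
have := hb u h2'; rewrite -/r ler_norml => /andP[hlo hhi].
have hr3 : r ^+ 3 = u ^+ 2 * r by rewrite -hu2; ring.
have hu20 : 0 <= u ^+ 2 by apply: sqr_ge0.
rewrite hr3 in hlo hhi.
apply/andP; split; last first.
  apply: le_trans (expR_ge1Dx _).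
  have : u ^+ 2 * (r * C) <= u ^+ 2 * (k / 2) by apply: ler_wpM2l.
  have : 0 <= u ^+ 2 * k by rewrite mulr_ge0 // ltW.
  move: hhi; lra.
pose w := V / 2 - r * C; pose y := u ^+ 2 * w.
have hw0 : 0 <= w by rewrite /w; lra.
have hrC : 0 <= r * C by rewrite mulr_ge0 // ltW.
have hwV : w <= V / 2 by rewrite /w; lra.
have hy0 : 0 <= y by rewrite mulr_ge0.
have hM : 1 + y <= mgf u by rewrite /y /w; move: hlo; lra.
apply: le_trans hM; apply: le_trans (expR_div_le hy0); rewrite ler_expR.
have h1y : 0 < 1 + y by lra.
have hyy : y - y ^+ 2 <= y / (1 + y).
  rewrite ler_pdivlMr //.
  have -> : (y - y ^+ 2) * (1 + y) = y - y ^+ 3 by ring.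
  by rewrite gerBl exprn_ge0.
apply: le_trans hyy.
have -> : y - y ^+ 2 = u ^+ 2 * (w - u ^+ 2 * w ^+ 2) by rewrite /y; ring.
apply: ler_wpM2l => //.
have hw2 : w ^+ 2 <= V ^+ 2 / 4.
  have -> : V ^+ 2 / 4 = (V / 2) ^+ 2 by field.
  by rewrite lerXn2r // nnegrE; lra.
have hur : u ^+ 2 <= r by rewrite -hu2 expr2; apply: ler_piMl => //; exact: ltW.
have : u ^+ 2 * w ^+ 2 <= r * (V ^+ 2 / 4).
  by apply: ler_pM => //; apply: exprn_ge0.
rewrite /w; lra.
Qed.
End Mgf.

(* Only the moment generating function of the sample is used, so no independence
   structure has to be set up: (p, S) plays the role of the law of an n-fold sum. *)
Lemma chernoff_ge (K : finType) (p S : K -> R) (s b : R) :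
  (forall k, 0 <= p k) -> 0 <= s ->
  \sum_(k | b <= S k) p k <= expR (- (s * b)) * \sum_k p k * expR (s * S k).
Proof.
move=> hp hs; rewrite mulr_sumr [leLHS]big_mkcond; apply: ler_sum => k _.
case: ifP => h; last by rewrite !mulr_ge0 ?expR_ge0.
rewrite mulrCA -expRD ler_peMr // -expR0 ler_expR addrC subr_ge0.
by rewrite ler_wpM2l.
Qed.

(** Controls the part of a tilted sum below b: there exp(v (b - S)) >= 1, which lowers the tilt from
    s to s - v. [chernoff_gt] is the mirror image above b. *)
Lemma chernoff_lt (K : finType) (p S : K -> R) (s v b : R) :
  (forall k, 0 <= p k) -> 0 <= v ->
  \sum_(k | S k < b) p k * expR (s * S k)
    <= expR (v * b) * \sum_k p k * expR ((s - v) * S k).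
Proof.
move=> hp hv; rewrite mulr_sumr [leLHS]big_mkcond; apply: ler_sum => k _.
case: ifP => h; last by rewrite !mulr_ge0 ?expR_ge0.
rewrite mulrCA -expRD; apply: ler_wpM2l => //; rewrite ler_expR mulrBl.
by rewrite addrCA lerDl subr_ge0 ler_wpM2l // ltW.
Qed.

(** Chernoff's bound at s = a / V, the minimiser of s^2 V / 2 - s a. *)
Lemma md_upper V (M : R -> R) (eps : R) : 0 < V -> 0 < eps ->
  (forall k : R, 0 < k -> exists2 delta : R, 0 < delta &
    forall u, `|u| < delta -> expR (u ^+ 2 * (V / 2 - k)) <= M u <= expR (u ^+ 2 * (V / 2 + k))) ->
  exists2 delta : R, 0 < delta &
  forall (n : nat) (a : R) (K : finType) (p S : K -> R), 0 < a < delta ->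
    (forall k, 0 <= p k) -> (forall u, \sum_k p k * expR (u * S k) = M u ^+ n) ->
    \sum_(k | n%:R * a <= S k) p k <= expR (- (n%:R * a ^+ 2 * ((2 * V)^-1 - eps))).
Proof.
(* With this k the error s^2 k equals eps a^2 at s = a / V. *)
move=> hV he hM; have hk : 0 < eps * V ^+ 2 by rewrite mulr_gt0 // exprn_gt0.
have [d hd hMd] := hM _ hk.
exists (d * V); first by rewrite mulr_gt0.
move=> n a K p S /andP[ha had] hp hmgf.
have hs : 0 < a / V by rewrite divr_gt0.
apply: (le_trans (chernoff_ge S (n%:R * a) hp (ltW hs))); rewrite hmgf.
have hsd : `|a / V| < d by rewrite gtr0_norm // ltr_pdivrMr.
have /andP[_ h2] := hMd _ hsd.
have h0 : 0 <= M (a / V) by apply: le_trans (expR_ge0 _) (proj1 (andP (hMd _ hsd))).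
have h3 : M (a / V) ^+ n <= expR (n%:R * ((a / V) ^+ 2 * (V / 2 + eps * V ^+ 2))).
  by rewrite expRM_natl lerXn2r // nnegrE // expR_ge0.
apply: (le_trans (ler_wpM2l (expR_ge0 _) h3)); rewrite -expRD ler_expR.
rewrite le_eqVlt; apply/orP; left; apply/eqP; field; lra.
Qed.

Lemma chernoff_gt (K : finType) (p S : K -> R) (s v b : R) :
  (forall k, 0 <= p k) -> 0 <= v ->
  \sum_(k | b <= S k) p k * expR (s * S k)
    <= expR (- (v * b)) * \sum_k p k * expR ((s + v) * S k).
Proof.
move=> hp hv; rewrite mulr_sumr [leLHS]big_mkcond; apply: ler_sum => k _.
case: ifP => h; last by rewrite !mulr_ge0 ?expR_ge0.
rewrite mulrCA -expRD; apply: ler_wpM2l => //; rewrite ler_expR mulrDl.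
by rewrite addrCA lerDl addrC subr_ge0 ler_wpM2l.
Qed.

Lemma expR_le_inv x : 0 <= x -> expR (- x) <= (1 + x)^-1.
Proof.
by move=> hx; rewrite expRN lef_pV2 ?posrE ?expR_gt0 ?expR_ge1Dx //; lra.
Qed.

(* Exponential tilting at s = a (1 + eta) / V: all but a fraction of M(s)^n comes from
   sample values between n a and n a (1 + 2 eta). *)
Lemma md_lower V (M : R -> R) (eps : R) : 0 < V -> 0 < eps ->
  (forall k : R, 0 < k -> exists2 delta : R, 0 < delta &
    forall u, `|u| < delta -> expR (u ^+ 2 * (V / 2 - k)) <= M u <= expR (u ^+ 2 * (V / 2 + k))) ->
  exists2 delta : R, 0 < delta & exists c : R,
  forall (n : nat) (a : R) (K : finType) (p S : K -> R), 0 < a < delta ->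
    c <= n%:R * a ^+ 2 ->
    (forall k, 0 <= p k) -> (forall u, \sum_k p k * expR (u * S k) = M u ^+ n) ->
    expR (- (n%:R * a ^+ 2 * ((2 * V)^-1 + eps))) <= \sum_(k | n%:R * a <= S k) p k.
Proof.
move=> hV he hM; pose eta := Num.min 1 (eps * V / 6).
have heta0 : 0 < eta by rewrite lt_min ltr01 divr_gt0 ?mulr_gt0.
have heta1 : eta <= 1 by rewrite ge_min lexx.
have hetae : eta <= eps * V / 6 by rewrite ge_min lexx orbT.
clearbody eta.
(* Both tails gain A eta^2 / 2 in the exponent, where A = n a^2 / V. The squared relative tilts sum
   to at most 4 + 9 = 13, so 52 = 4 * 13 limits the expansion error to half of this gain. *)
have hk : 0 < V * eta ^+ 2 / 52 by rewrite divr_gt0 // mulr_gt0 // exprn_gt0.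
have [d hd hMd] := hM _ hk.
(* All tilts used are a t / V with t one of 1, 1 + eta, 1 + 2 eta, hence t <= 3. *)
exists (d * V / 3); first by rewrite divr_gt0 // mulr_gt0.
(* Makes A eta^2 >= 12, so the remaining gain A eta^2 / 4 is at least 3 and each tail is at most
   exp(-3) <= 1/4 of the main term. *)
exists (12 * V / eta ^+ 2) => n a K p S /andP[ha had] hc hp hmgf.
pose A := n%:R * a ^+ 2 / V.
have hA : 12 <= A * eta ^+ 2.
  by rewrite /A mulrAC ler_pdivlMr // -ler_pdivrMr // exprn_gt0.
have hVi : 0 <= V^-1 by rewrite invr_ge0 ltW.
have ha0 := ltW ha; have he0 := ltW heta0.
have hA0 : 0 <= A by apply: mulr_ge0 => //; apply: mulr_ge0; rewrite ?ler0n ?sqr_ge0.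
pose s := a * (1 + eta) / V; pose v := a * eta / V.
pose b := n%:R * a; pose b' := n%:R * a * (1 + 2 * eta).
have hb : b <= b'.
  by rewrite /b'; apply: ler_peMr; [apply: mulr_ge0; rewrite ?ler0n|lra].
have hv : 0 <= v by apply: mulr_ge0 => //; apply: mulr_ge0.
have hs : 0 <= s by apply: mulr_ge0 => //; apply: mulr_ge0 => //; lra.
have hsmall t : 0 <= t -> t <= 3 -> `|a * t / V| < d.
  move=> ht0 ht3; rewrite ger0_norm ?divr_ge0 ?mulr_ge0 ?(ltW ha) ?(ltW hV) //.
  rewrite ltr_pdivrMr //; apply: (@le_lt_trans _ _ (a * 3)).
    by apply: ler_wpM2l => //; exact: ltW.
  by rewrite -ltr_pdivlMr.
have hMs : expR (n%:R * (s ^+ 2 * (V / 2 - V * eta ^+ 2 / 52))) <= M s ^+ n.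
  have /andP[h1 _] := hMd s (hsmall (1 + eta) ltac:(lra) ltac:(lra)).
  by rewrite expRM_natl lerXn2r // nnegrE; [exact: expR_ge0 | apply: le_trans h1; exact: expR_ge0].
have hMu t : 0 <= t -> t <= 3 -> M (a * t / V) ^+ n <=
    expR (n%:R * ((a * t / V) ^+ 2 * (V / 2 + V * eta ^+ 2 / 52))).
  move=> ht0 ht3; have /andP[h1 h2] := hMd _ (hsmall t ht0 ht3).
  by rewrite expRM_natl lerXn2r // nnegrE; [apply: le_trans h1; exact: expR_ge0 | exact: expR_ge0].
pose X0 := n%:R * (s ^+ 2 * (V / 2 - V * eta ^+ 2 / 52)).
have e3 : expR (- 3 : R) <= 4^-1.
  by have := @expR_le_inv 3 ltac:(lra); rewrite (_ : 1 + 3 = 4) //; lra.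
have T1 : expR (v * b) * M (s - v) ^+ n <= expR X0 / 4.
  have -> : s - v = a * 1 / V by rewrite /s /v; field; lra.
  apply: (le_trans (ler_wpM2l (expR_ge0 _) (hMu 1 ltac:(lra) ltac:(lra)))).
  apply: le_trans (ler_wpM2l (expR_ge0 X0) e3); rewrite -!expRD ler_expR.
  rewrite -subr_ge0 /X0.
  have -> : n%:R * (s ^+ 2 * (V / 2 - V * eta ^+ 2 / 52)) + -3 -
    (v * b + n%:R * ((a * 1 / V) ^+ 2 * (V / 2 + V * eta ^+ 2 / 52)))
    = A * eta ^+ 2 / 4 - 3 + A * eta ^+ 2 * (1 / 4 - ((1 + eta) ^+ 2 + 1) / 52).
    by rewrite /s /v /b /A; field; lra.
  have : 0 <= A * eta ^+ 2 * (1 / 4 - ((1 + eta) ^+ 2 + 1) / 52).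
    by apply: mulr_ge0; [apply: mulr_ge0 => //; exact: sqr_ge0 | nra].
  lra.
have T2 : expR (- (v * b')) * M (s + v) ^+ n <= expR X0 / 4.
  have -> : s + v = a * (1 + 2 * eta) / V by rewrite /s /v; field; lra.
  apply: (le_trans (ler_wpM2l (expR_ge0 _) (hMu (1 + 2 * eta) ltac:(lra) ltac:(lra)))).
  apply: le_trans (ler_wpM2l (expR_ge0 X0) e3); rewrite -!expRD ler_expR.
  rewrite -subr_ge0 /X0.
  have -> : n%:R * (s ^+ 2 * (V / 2 - V * eta ^+ 2 / 52)) + -3 -
    (- (v * b') + n%:R * ((a * (1 + 2 * eta) / V) ^+ 2 * (V / 2 + V * eta ^+ 2 / 52)))
    = A * eta ^+ 2 / 4 - 3 + A * eta ^+ 2 * (1 / 4 - ((1 + eta) ^+ 2 + (1 + 2 * eta) ^+ 2) / 52).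
    by rewrite /s /v /b' /A; field; lra.
  have : 0 <= A * eta ^+ 2 * (1 / 4 - ((1 + eta) ^+ 2 + (1 + 2 * eta) ^+ 2) / 52).
    by apply: mulr_ge0; [apply: mulr_ge0 => //; exact: sqr_ge0 | nra].
  lra.
pose P := \sum_(k | b <= S k) p k.
have hP0 : 0 <= P by apply: sumr_ge0.
have hsplit : M s ^+ n <= \sum_(k | S k < b) p k * expR (s * S k)
    + \sum_(k | b' <= S k) p k * expR (s * S k) + expR (s * b') * P.
  rewrite -hmgf /P mulr_sumr !(big_mkcond (fun k => S k < b)) (big_mkcond (fun k => b' <= S k)).
  rewrite (big_mkcond (fun k => b <= S k)) -!big_split /=; apply: ler_sum => k _.
  have h0 : 0 <= p k * expR (s * S k) by rewrite mulr_ge0 ?expR_ge0.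
  have h0' : 0 <= expR (s * b') * p k by rewrite mulr_ge0 ?expR_ge0.
  have [h1|h1] := ltrP (S k) b; first by case: ifP => _; lra.
  have [h2|h2] := lerP b' (S k); first by lra.
  rewrite !add0r mulrC; apply: ler_wpM2r => //.
  by rewrite ler_expR ler_wpM2l // ltW.
have L1 := le_trans (@chernoff_lt K p S s v b hp hv) ltac:(rewrite hmgf; exact: T1).
have L2 := le_trans (@chernoff_gt K p S s v b' hp hv) ltac:(rewrite hmgf; exact: T2).
(* The two tails take at most a quarter each, so the window between b and b' carries at least
   half. *)
have hmain : expR X0 / 2 <= expR (s * b') * P by move: hMs hsplit L1 L2; rewrite -/X0; lra.
have hAeta : 12 <= A * eta.
  apply: (le_trans hA); rewrite ler_wpM2l // expr2 ger_pMr //.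
(* Turns the factor 1/2 into an extra exponent A eta, which is of the same order as the other
   losses. *)
have h12 : expR (- (A * eta)) <= 2^-1.
  apply: (le_trans (expR_le_inv _)); first lra.
  by rewrite lef_pV2 ?posrE; lra.
have hfin : expR (X0 - s * b' - A * eta) <= P.
  have -> : X0 - s * b' - A * eta = (- (s * b')) + (X0 + - (A * eta)) by ring.
  rewrite 2!expRD expRN ler_pdivrMl ?expR_gt0 //.
  by apply: le_trans hmain; apply: ler_wpM2l; first exact: expR_ge0.
apply: le_trans hfin; rewrite ler_expR -subr_ge0 /X0.
have -> : n%:R * (s ^+ 2 * (V / 2 - V * eta ^+ 2 / 52)) - s * b' - A * eta -
   - (n%:R * a ^+ 2 * ((2 * V)^-1 + eps))
   = A * (6 * (eps * V / 6 - eta))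
     + A * eta * (3 - 3 / 2 * eta - (1 + eta) ^+ 2 * eta / 52).
  by rewrite /s /b' /A; field; lra.
apply: addr_ge0; first by rewrite mulr_ge0 // mulr_ge0 // subr_ge0.
by apply: mulr_ge0; [lra | nra].
Qed.
End ClassicalModerateDeviations.

(** * The log-likelihood law of a pair of states *)

Section SpectralLaw.
Variable R : realType.
Local Notation C := R[i].
Local Notation Re := complex.Re.
Local Open Scope complex_scope.

(** Commuting matrices are triangularised by one unitary, and a Hermitian triangular matrix is
    diagonal. *)
Lemma commuting_fcalc n (X Z : 'M[C]_n) : psd X -> psd Z -> X *m Z = Z *m X ->
  exists Y x z, [/\ unitary Y, forall i, 0 <= x i, forall i, 0 <= z i,
    X = fcalc Y x & Z = fcalc Y z].
Proof.
move=> hX hZ /cotrigonalization2[Y hYu /andP[tX tZ]].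
have hY : unitary Y by move/unitarymxP: hYu; rewrite /unitary /adjmx map_trmx.
have diag (M : 'M[C]_n) : psd M -> similar_trig Y M ->
    exists2 d : 'I_n -> R, (forall i, 0 <= d i) & M = fcalc Y d.
  move=> hM; rewrite /similar_to /= conjymx // -map_trmx -/(adjmx Y) => /is_trig_mxP ht.
  set D := Y *m M *m adjmx Y in ht.
  have hDa : adjmx D = D by rewrite /D !adjmxM adjmxK (psd_adj hM) mulmxA.
  have hpos i : 0 <= D i i.
    rewrite /D qform_row; have := hM (row i Y).
    by rewrite -/(adjmx (row i Y)) adjmxK.
  have hD : D = diagC (fun i => Re (D i i)).
    apply/matrixP => i j; rewrite diagCE; have [<-|nij] := eqVneq i j.
      by rewrite mulr1n RRe_real // ger0_real.
    rewrite mulr0n; case: (ltngtP i j) => hij; first exact: ht.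
      by rewrite -hDa adjmxE ht // rmorph0.
    by move/eqP: nij; case; apply/val_inj.
  exists (fun i => Re (D i i)).
    by move=> i; have := hpos i; rewrite lecE => /andP[].
  by rewrite fcalcE -hD /D !mulmxA (unitaryV hY) mul1mx -mulmxA (unitaryV hY) mulmx1.
have [x hx eX] := diag X hX tX; have [z hz eZ] := diag Z hZ tZ.
by exists Y, x, z.
Qed.

Lemma overlap_sym n (U W : 'M[C]_n) i j : overlap U W i j = overlap W U j i.
Proof.
rewrite /overlap -sqnorm_conj -adjmxE; congr (sqnorm (_ j i)).
by rewrite adjmxM adjmxK.
Qed.

Lemma fcalc_marginal n (U W : 'M[C]_n) lam j :
  \sum_i lam i * overlap U W i j = Re ((W *m fcalc U lam *m adjmx W) j j).
Proof.
by rewrite fcalc_overlap; apply: eq_bigr => i _; rewrite overlap_sym.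
Qed.

(** Because the second basis is a product basis, summing the weights over i and b reads off a
    diagonal entry of the reduced state in its own eigenbasis. *)
Lemma marginalA dA dB (U : 'M[C]_(dA * dB)) (YA : 'M[C]_dA) (YB : 'M[C]_dB) lam mA a :
  unitary YA -> unitary YB -> ptraceB (fcalc U lam) = fcalc YA mA ->
  \sum_b \sum_i lam i * overlap U (YA *t YB) i (mxtens_index (a, b)) = mA a.
Proof.
move=> hA hB h; under eq_bigr do rewrite fcalc_marginal.
by rewrite -Re_sum ptraceB_conj // h fcalc_conj // diagCE eqxx.
Qed.

Lemma marginalB dA dB (U : 'M[C]_(dA * dB)) (YA : 'M[C]_dA) (YB : 'M[C]_dB) lam mB b :
  unitary YA -> unitary YB -> ptraceA (fcalc U lam) = fcalc YB mB ->
  \sum_a \sum_i lam i * overlap U (YA *t YB) i (mxtens_index (a, b)) = mB b.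
Proof.
move=> hA hB h; under eq_bigr do rewrite fcalc_marginal.
by rewrite -Re_sum ptraceA_conj // h fcalc_conj // diagCE eqxx.
Qed.

(** Each weight is a single term of the nonnegative sums in [marginalA] and [marginalB]. Hence no
    weight sits where the product of the marginals has eigenvalue 0. *)
Lemma overlap_support dA dB (U : 'M[C]_(dA * dB)) (YA : 'M[C]_dA) (YB : 'M[C]_dB)
    lam mA mB i a b :
  unitary YA -> unitary YB -> ptraceB (fcalc U lam) = fcalc YA mA ->
  ptraceA (fcalc U lam) = fcalc YB mB -> (forall k, 0 <= lam k) ->
  lam i * overlap U (YA *t YB) i (mxtens_index (a, b)) <= mA a
  /\ lam i * overlap U (YA *t YB) i (mxtens_index (a, b)) <= mB b.
Proof.
move=> hA hB h1 h2 hl.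
have h0 k j : 0 <= lam k * overlap U (YA *t YB) k j by rewrite mulr_ge0 ?overlap_ge0.
rewrite -(marginalA a hA hB h1) -(marginalB b hA hB h2); split.
  rewrite (bigD1 b) //= (bigD1 i) //= -addrA lerDl.
  by rewrite addr_ge0 ?sumr_ge0 // => k _; rewrite sumr_ge0.
rewrite (bigD1 a) //= (bigD1 i) //= -addrA lerDl.
by rewrite addr_ge0 ?sumr_ge0 // => k _; rewrite sumr_ge0.
Qed.

(** Reality of the trace lets [Re] pass through the n-th power in [spectral_mgf_pow]. *)
Lemma mxtrace_herm_mul n (F G : 'M[C]_n) : adjmx F = F -> adjmx G = G ->
  \tr (F *m G) = (Re (\tr (F *m G)))%:C.
Proof.
move=> hF hG; rewrite RRe_real //; apply/CrealP.
by rewrite -mxtrace_adj adjmxM hF hG mxtrace_mulC.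
Qed.

(* x ^ u on the support, extended by 0 so that it stays multiplicative on [0, +oo[. *)
Definition supp_pow (u x : R) : R := if 0 < x then expR (u * ln x) else 0.

Lemma supp_powM u x y : 0 <= x -> 0 <= y ->
  supp_pow u (x * y) = supp_pow u x * supp_pow u y.
Proof.
rewrite /supp_pow !le0r => /predU1P[->|x0] /predU1P[->|y0];
  rewrite ?mul0r ?mulr0 ?ltxx ?mul0r ?mulr0 //.
by rewrite mulr_gt0 // x0 y0 lnM ?posrE // mulrDr expRD.
Qed.

Lemma supp_pow_prod u n (x : 'I_n -> R) : (forall k, 0 <= x k) ->
  supp_pow u (\prod_k x k) = \prod_k supp_pow u (x k).
Proof.
move=> hx; suff [] : supp_pow u (\prod_k x k) = \prod_k supp_pow u (x k) /\ 0 <= \prod_k x k by [].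
apply: (big_ind2 (fun y z => supp_pow u y = z /\ 0 <= y)).
- by rewrite /supp_pow ltr01 ln1 mulr0 expR0 ler01.
- by move=> x1 x2 y1 y2 [<- h1] [<- h2]; rewrite supp_powM ?mulr_ge0.
- by move=> k _; split.
Qed.

Lemma fcalc_gpow_map N D n (dg : 'I_N -> 'I_n -> 'I_D) (hdg : digits_bij dg)
    (U : 'M[C]_D) (d : 'I_D -> R) (Un : 'M[C]_N) (dn : 'I_N -> R) (f : R -> R) :
  unitary U -> unitary Un -> gpow dg (fcalc U d) = fcalc Un dn ->
  (forall i, f (\prod_k d (dg i k)) = \prod_k f (d (dg i k))) ->
  fcalc Un (f \o dn) = gpow dg (fcalc U (f \o d)).
Proof.
move=> hU hUn h hf; rewrite (gpow_fcalc hdg).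
have hUn' := gpow_unitary hdg hU; rewrite (gpow_fcalc hdg) in h.
by rewrite -(fcalc_unique f hUn' hUn h); congr fcalc; apply/funext => i /=.
Qed.

(** The double sum is tr(rho^(1+u) sigma^(-u)), with powers taken on supports. It is multiplicative
    over tensor powers and independent of the chosen eigenbases, so [Un] and [Wn] need not be tensor
    powers of [U] and [W]. *)
Lemma spectral_mgf_pow dA dB n (U W : 'M[C]_(dA * dB)) lam mu
    (Un Wn : 'M[C]_(dA ^ n * dB ^ n)) ln mn u :
  unitary U -> unitary W -> unitary Un -> unitary Wn ->
  (forall i, 0 <= lam i) -> (forall i, 0 <= mu i) ->
  tpowAB n (fcalc U lam) = fcalc Un ln -> tpowAB n (fcalc W mu) = fcalc Wn mn ->
  \sum_i \sum_j ln i * overlap Un Wn i j * supp_pow u (ln i) * supp_pow (- u) (mn j)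
  = (\sum_i \sum_j lam i * overlap U W i j * supp_pow u (lam i) * supp_pow (- u) (mu j)) ^+ n.
Proof.
move=> hU hW hUn hWn hl hm h1 h2.
pose f x := x * supp_pow u x.
have hdg := digitAB_bij dA dB n.
have e1 : fcalc Un (f \o ln) = gpow (@digitAB dA dB n) (fcalc U (f \o lam)).
  apply: (fcalc_gpow_map hdg) => // i; rewrite /f supp_pow_prod ?big_split //=.
have e2 : fcalc Wn (supp_pow (- u) \o mn) = gpow (@digitAB dA dB n) (fcalc W (supp_pow (- u) \o mu)).
  by apply: (fcalc_gpow_map hdg) => // i; rewrite supp_pow_prod.
have rw m (A B : 'M[C]_m) (x y : 'I_m -> R) :
   \sum_i \sum_j x i * overlap A B i j * supp_pow u (x i) * supp_pow (- u) (y j)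
   = Re (\tr (fcalc A (f \o x) *m fcalc B (supp_pow (- u) \o y))).
  rewrite mxtrace_fcalc2; apply: eq_bigr => i _; apply: eq_bigr => j _ /=.
  by rewrite /f; ring.
rewrite !rw e1 e2 -(gpowM hdg) (mxtrace_gpow hdg).
rewrite mxtrace_herm_mul ?adjmx_fcalc // -rmorphXn //.
Qed.

(* Pairs with a vanishing eigenvalue are removed, so ln is only taken of positive numbers. *)
Definition ns_law N (U W : 'M[C]_N) (lam mu : 'I_N -> R) (k : 'I_N * 'I_N) : R :=
  if (0 < lam k.1) && (0 < mu k.2) then lam k.1 * overlap U W k.1 k.2 else 0.

Definition ns_llr N (lam mu : 'I_N -> R) (c : R) (k : 'I_N * 'I_N) : R :=
  ln (lam k.1) - ln (mu k.2) - c.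

Lemma ns_law_ge0 N (U W : 'M[C]_N) lam mu k : 0 <= ns_law U W lam mu k.
Proof.
by rewrite /ns_law; case: ifP => // /andP[h _]; rewrite mulr_ge0 ?overlap_ge0 // ltW.
Qed.

Lemma ns_law_mgf N (U W : 'M[C]_N) lam mu c u : (forall i, 0 <= lam i) ->
  \sum_k ns_law U W lam mu k * expR (u * ns_llr lam mu c k)
  = expR (- (u * c)) *
    \sum_i \sum_j lam i * overlap U W i j * supp_pow u (lam i) * supp_pow (- u) (mu j).
Proof.
move=> hl; rewrite -(pair_bigA _ (fun i j =>
  ns_law U W lam mu (i, j) * expR (u * ns_llr lam mu c (i, j)))) /= mulr_sumr.
apply: eq_bigr => i _; rewrite mulr_sumr; apply: eq_bigr => j _.
rewrite /ns_law /ns_llr /supp_pow /=.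
have [l0|l0] := ltrP 0 (lam i); last by rewrite mulr0 !mul0r mulr0.
have [m0|m0] := ltrP 0 (mu j); last by rewrite mul0r !mulr0.
have -> : u * (ln (lam i) - ln (mu j) - c)
   = - (u * c) + (u * ln (lam i) + - u * ln (mu j)) by ring.
by rewrite !expRD /=; ring.
Qed.

Lemma sum_ns_law N (U W : 'M[C]_N) lam mu (F : 'I_N * 'I_N -> R) :
  (forall i, 0 <= lam i) -> (forall j, 0 <= mu j) ->
  (forall i j, mu j = 0 -> lam i * overlap U W i j = 0) ->
  \sum_k ns_law U W lam mu k * F k = \sum_i \sum_j lam i * overlap U W i j * F (i, j).
Proof.
move=> hl hm h0.
have -> : \sum_k ns_law U W lam mu k * F k
    = \sum_i \sum_j ns_law U W lam mu (i, j) * F (i, j).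
  by rewrite pair_bigA; apply: eq_bigr => -[].
apply: eq_bigr => i _; apply: eq_bigr => j _; rewrite /ns_law /=.
have := hl i; rewrite le0r => /predU1P[->|->]; first by rewrite ltxx !mul0r.
have := hm j; rewrite le0r => /predU1P[hj|->//]; by rewrite hj ltxx h0.
Qed.

Lemma fcalc_logm n (M U : 'M[C]_n) d : psd M -> unitary U -> M = fcalc U d ->
  logm M = fcalc U (fun i => ln (d i)).
Proof.
move=> hM hU h; have [hU' _ hM' ->] := psd_spectral hM.
by apply: (@fcalc_unique R n _ _ _ _ (@ln R)) => //; rewrite -hM' h.
Qed.

Lemma entropy_fcalc n (M U : 'M[C]_n) d : psd M -> unitary U -> M = fcalc U d ->
  entropy M = - \sum_i d i * ln (d i).
Proof.
move=> hM hU h; rewrite /entropy (fcalc_logm hM hU h) {1}h (fcalcM _ _ hU).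
rewrite -[X in \tr X]mulmx1 mxtrace_fcalc_mul; congr (- _); apply: eq_bigr => i _.
by rewrite mulmx1 hU mxE eqxx mulr1.
Qed.

(** * Mean and variance of the log-likelihood ratio for one copy *)

Section SingleCopy.
Variables (dA dB : nat) (rho : 'M[C]_(dA * dB)).
Variables (U : 'M[C]_(dA * dB)) (WA : 'M[C]_dA) (WB : 'M[C]_dB).
Variables (lam : 'I_(dA * dB) -> R) (al : 'I_dA -> R) (be : 'I_dB -> R).
Hypotheses (hrho : density rho) (hU : unitary U) (hWA : unitary WA) (hWB : unitary WB).
Hypotheses (hl : forall i, 0 <= lam i) (ha : forall i, 0 <= al i) (hb : forall i, 0 <= be i).
Hypotheses (erho : rho = fcalc U lam) (eA : ptraceB rho = fcalc WA al)
  (eB : ptraceA rho = fcalc WB be).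
Let W := WA *t WB.
Let mu k := al (mxtens_unindex k).1 * be (mxtens_unindex k).2.
Let q := ns_law U W lam mu.
Let X := ns_llr lam mu (mutual_info rho).

Let hW : unitary W. Proof. exact: unitary_tens. Qed.
Let hm k : 0 <= mu k. Proof. by rewrite mulr_ge0. Qed.

Let h0 i j : mu j = 0 -> lam i * overlap U W i j = 0.
Proof.
case: (mxtens_indexP j) => a b; rewrite /mu mxtens_indexK /= => /eqP hab.
have eA' := eA; have eB' := eB; rewrite erho in eA' eB'.
have [h1 h2] := overlap_support i a b hWA hWB eA' eB' hl.
apply/eqP; rewrite eq_le mulr_ge0 ?overlap_ge0 // andbT.
by move: hab; rewrite mulf_eq0 => /orP[/eqP h|/eqP h]; rewrite -h.
Qed.

Let sum_lam : \sum_i lam i = 1.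
Proof.
have := congr1 (fun M => Re (\tr (M *m 1%:M))) erho; rewrite mxtrace_fcalc_mul mulmx1.
case: hrho => _ -> /= ->; apply: eq_bigr => i _.
by rewrite mulmx1 hU mxE eqxx mulr1.
Qed.

Lemma sum_ns_law1 : \sum_k q k = 1.
Proof.
have := sum_ns_law (fun=> 1) hl hm h0.
under eq_bigr do rewrite mulr1.
move=> ->; rewrite -[RHS]sum_lam -(sum_overlap lam hU hW).
by apply: eq_bigr => i _; apply: eq_bigr => j _; rewrite mulr1.
Qed.

Lemma mean_ns_llr : \sum_k q k * X k = 0.
Proof.
rewrite /X /ns_llr.
under eq_bigr do rewrite mulrBr.
rewrite sumrB -mulr_suml sum_ns_law1 mul1r; apply/eqP; rewrite subr_eq0; apply/eqP.
rewrite (sum_ns_law (fun k => ln (lam k.1) - ln (mu k.2)) hl hm h0) /=.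
have -> : \sum_i \sum_j lam i * overlap U W i j * (ln (lam i) - ln (mu j))
  = \sum_i \sum_j lam i * ln (lam i) * overlap U W i j
   - (\sum_j \sum_i lam i * overlap U W i j * ln (al (mxtens_unindex j).1)
     + \sum_j \sum_i lam i * overlap U W i j * ln (be (mxtens_unindex j).2)).
  rewrite -big_split /=.
  under [X in _ = _ - X]eq_bigr do rewrite -big_split /=.
  rewrite [X in _ = _ - X]exchange_big /= -sumrB; apply: eq_bigr => i _.
  rewrite -sumrB; apply: eq_bigr => j _.
  (* Where mu_j = 0 the logarithm does not split into a sum, but there the weight vanishes. *)
  have [hj|hj] := eqVneq (mu j) 0.
    by rewrite -(mulrAC _ (overlap _ _ _ _)) !(h0 _ hj) !mul0r addr0 subr0.
  have [a0 b0] : 0 < al (mxtens_unindex j).1 /\ 0 < be (mxtens_unindex j).2.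
    by move: hj; rewrite /mu mulf_eq0 negb_or => /andP[h1 h2]; rewrite !lt_neqAle !ha !hb !(eq_sym 0) h1 h2.
  by rewrite /mu lnM ?posrE //; ring.
rewrite (sum_overlap _ hU hW) [X in _ - (X + _)]sum_tens_index.
rewrite [X in _ - (_ + X)]sum_tens_index [X in _ - (_ + X)]exchange_big /=.
have eA' := eA; have eB' := eB; rewrite erho in eA' eB'.
have -> : \sum_a \sum_b \sum_i lam i * overlap U W i (mxtens_index (a, b)) *
    ln (al (mxtens_unindex (mxtens_index (a, b))).1) = \sum_a al a * ln (al a).
  apply: eq_bigr => a _; rewrite -[X in _ = X * _](marginalA a hWA hWB eA') mulr_suml.
  by apply: eq_bigr => b _; rewrite mulr_suml; apply: eq_bigr => i _; rewrite mxtens_indexK.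
have -> : \sum_b \sum_a \sum_i lam i * overlap U W i (mxtens_index (a, b)) *
    ln (be (mxtens_unindex (mxtens_index (a, b))).2) = \sum_b be b * ln (be b).
  apply: eq_bigr => b _; rewrite -[X in _ = X * _](marginalB b hWA hWB eB') mulr_suml.
  by apply: eq_bigr => a _; rewrite mulr_suml; apply: eq_bigr => i _; rewrite mxtens_indexK.
have [hp _] := hrho; rewrite erho in hp.
rewrite /mutual_info erho (entropy_fcalc (psd_ptraceB hp) hWA eA').
rewrite (entropy_fcalc (psd_ptraceA hp) hWB eB') (entropy_fcalc hp hU erefl).
ring.
Qed.

(** The matrix element of L between x_i and y_j is X_ij times their overlap amplitude, so expanding
    tr(rho L adj(L)) in both bases gives the second moment without rho commuting with the product
    state. *)
Lemma var_ns_llr : \sum_k q k * X k ^+ 2 = mutual_info_var rho.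
Proof.
rewrite (sum_ns_law (fun k => X k ^+ 2) hl hm h0) /mutual_info_var.
set L := logm rho - _ - _.
have [hp _] := hrho.
have hs : psd (ptraceB rho *t ptraceA rho).
  by apply: psd_tens; [apply: psd_ptraceB | apply: psd_ptraceA].
have eS : ptraceB rho *t ptraceA rho = fcalc W mu by rewrite eA eB fcalc_tens.
have eL : L = fcalc U (fun i => ln (lam i)) - fcalc W (fun j => ln (mu j))
    - (mutual_info rho)%:C%:M.
  by rewrite /L (fcalc_logm hp hU erho) (fcalc_logm hs hW eS).
have hLa : adjmx L = L.
  rewrite eL !adjmxB !adjmx_fcalc; congr (_ - _).
  apply/matrixP => i j; rewrite adjmxE !mxE rmorphMn /= conjCR eq_sym //.
rewrite -{2}hLa erho (mxtrace_fcalc_gram U L lam hW).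
apply: eq_bigr => i _; apply: eq_bigr => j _.
suff -> : (U *m L *m adjmx W) i j = (X (i, j))%:C * (U *m adjmx W) i j.
  rewrite sqnormM -/(overlap U W i j) [sqnorm (X _)%:C]/sqnorm /= expr0n addr0.
  by ring.
rewrite eL !mulmxBr !mulmxBl.
have -> : U *m fcalc U (fun i => ln (lam i)) *m adjmx W
    = diagC (fun i => ln (lam i)) *m (U *m adjmx W).
  by rewrite fcalcE !mulmxA hU mul1mx.
have -> : U *m fcalc W (fun j => ln (mu j)) *m adjmx W
    = (U *m adjmx W) *m diagC (fun j => ln (mu j)).
  by rewrite fcalcE !mulmxA -[LHS]mulmxA hW mulmx1.
have hB (A B : 'M[C]_(dA * dB)) : (A - B) i j = A i j - B i j by rewrite !mxE.
rewrite !hB mul_diagCl mul_diagCr mul_mx_scalar -scalemxAl [X in _ - X]mxE.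
by rewrite /X /ns_llr /= !rmorphB /=; ring.
Qed.
End SingleCopy.
End SpectralLaw.

(** * Bounds at finite blocklength *)

Section AlphaBounds.
Variable R : realType.
Local Notation C := R[i].
Local Notation Re := complex.Re.
Local Open Scope complex_scope.
Variables (dA dB n : nat) (rho : 'M[C]_(dA * dB)).
Hypothesis hrho : density rho.
Implicit Types T : 'M[C]_(dA ^ n * dB ^ n).

Let hrn : density (tpowAB n rho).
Proof. exact: (density_gpow (digitAB_bij dA dB n)). Qed.

Let hcompl T : Re (\tr (tpowAB n rho *m (1%:M - T))) = 1 - Re (\tr (tpowAB n rho *m T)).
Proof. by rewrite mulmxBr mulmx1 linearB ReB /=; case: hrn => _ ->. Qed.

Let hcompl_ge0 T : test_op T -> 0 <= Re (\tr (tpowAB n rho *m (1%:M - T))).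
Proof. by case: hrn => h _ [_ h']; apply: mxtrace_psd_mul_ge0. Qed.

Lemma alpha_hat_achieve (m : R) T : test_op T ->
  (forall (sigma : 'M[C]_(dA ^ n)) (tau : 'M[C]_(dB ^ n)),
     density sigma -> perm_inv sigma -> density tau -> perm_inv tau ->
     Re (\tr ((sigma *t tau) *m T)) <= m) ->
  Re (\tr (tpowAB n rho *m T)) <= 1 - alpha_hat n rho m.
Proof.
move=> hT hm; rewrite lerBrDr addrC -lerBrDr -hcompl; apply: ge_inf.
  by exists 0 => _ [T' [hT' _ ->]]; apply: hcompl_ge0.
by exists T.
Qed.

(** Tensor powers of states are symmetric states, so a test feasible against all symmetric states is
    feasible here. The zero test shows that the set under the infimum is nonempty. *)
Lemma alpha_iid_le (m : R) : 0 <= m -> alpha_hat_iid n rho m <= alpha_hat n rho m.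
Proof.
move=> hm; apply: lb_le_inf.
  exists (Re (\tr (tpowAB n rho *m (1%:M - 0)))), 0; split=> //.
    exact: test_op0.
  by move=> *; rewrite mulmx0 linear0.
move=> _ [T [hT hfeas ->]]; apply: ge_inf.
  by exists 0 => _ [T' [hT' _ ->]]; apply: hcompl_ge0.
exists T; split => // sigma tau hs ht; apply: hfeas.
- exact: (density_gpow (digit_bij dA n)).
- exact: perm_inv_tpow.
- exact: (density_gpow (digit_bij dB n)).
- exact: perm_inv_tpow.
Qed.

Lemma alpha_iid_converse (m B : R) : 0 <= m ->
  (forall T, test_op T ->
    Re (\tr ((tpow n (ptraceB rho) *t tpow n (ptraceA rho)) *m T)) <= m ->
    Re (\tr (tpowAB n rho *m T)) <= B) ->
  1 - alpha_hat_iid n rho m <= B.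
Proof.
move=> hm hB; rewrite lerBlDr addrC -lerBlDr; apply: lb_le_inf.
  exists (Re (\tr (tpowAB n rho *m (1%:M - 0)))), 0; split=> //.
    exact: test_op0.
  by move=> *; rewrite mulmx0 linear0.
move=> _ [T [hT hfeas ->]]; rewrite hcompl lerD2l lerN2; apply: hB => //.
by apply: hfeas; [apply: density_ptraceB | apply: density_ptraceA].
Qed.
End AlphaBounds.

Section FiniteBlocklength.
Variable R : realType.
Local Notation C := R[i].
Local Notation Re := complex.Re.
Local Open Scope complex_scope.

Lemma sum_fcalc n (U : 'M[C]_n) d : unitary U -> Re (\tr (fcalc U d)) = \sum_i d i.
Proof.
move=> hU; rewrite -[fcalc _ _]mulmx1 mxtrace_fcalc_mul; apply: eq_bigr => i _.
by rewrite mulmx1 hU mxE eqxx mulr1.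
Qed.

(* One factor of the union bound: the eigenvalue z_a of the universal operator exceeds
   e^x m_a only with probability e^-x tr Z, by Markov's inequality. *)
Lemma markov_marginal (I J K : finType) (F : I -> J -> K -> R) (m z : J -> R) x :
  (forall a, \sum_b \sum_i F i a b = m a) -> (forall a, 0 <= m a) -> (forall a, 0 <= z a) ->
  \sum_a \sum_b \sum_i (if expR x * m a < z a then F i a b else 0)
    <= expR (- x) * \sum_a z a.
Proof.
move=> hF hm hz; rewrite mulr_sumr; apply: ler_sum => a _.
have [h|h] := ltrP (expR x * m a) (z a).
  by rewrite hF expRN ler_pdivlMl ?expR_gt0 //; exact: ltW.
rewrite big1 ?mulr_ge0 ?expR_ge0 // => b _; exact: big1.
Qed.

Lemma psd_tens_mono m n (Z s : 'M[C]_m) (Z' t : 'M[C]_n) :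
  psd (Z - s) -> psd s -> psd Z' -> psd (Z' - t) -> psd (Z *t Z' - s *t t).
Proof.
move=> h1 h2 h3 h4; have -> : Z *t Z' - s *t t = (Z - s) *t Z' + s *t (Z' - t).
  by apply/matrixP => i j; rewrite !mxE; ring.
by apply: psdD; apply: psd_tens.
Qed.

(** The interface between the quantum and the classical part: both error quantities are sandwiched
    between tails of a law known only through its moment generating function. The slack x stays free
    and is chosen later as a multiple of n a_n. *)
Lemma sample_law_bounds (dA dB : nat) (rho : 'M[C]_(dA * dB)) : density rho ->
  exists (J : finType) (q X : J -> R),
    [/\ forall k, 0 <= q k, \sum_k q k = 1, \sum_k q k * X k = 0,
        second_moment q X = mutual_info_var rho &
  forall n, exists (K : finType) (p S : K -> R),
    [/\ forall k, 0 <= p k, forall u, \sum_k p k * expR (u * S k) = mgf q X u ^+ n &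
   forall a x, let m := expR (- (n%:R * (mutual_info rho + a))) in
    [/\ \sum_(k | n%:R * a + 2 * x <= S k) p k
        - expR (- x) * ((n.+1 ^ (dA * dA))%:R + (n.+1 ^ (dB * dB))%:R)
         <= 1 - alpha_hat n rho m,
      1 - alpha_hat n rho m <= 1 - alpha_hat_iid n rho m &
      1 - alpha_hat_iid n rho m <= \sum_(k | n%:R * a - 2 * x <= S k) p k
         + 2 * expR (- x)]]].
Proof.
move=> hrho; have [hpsd htr] := hrho.
have [U [lam [hU hl erho]]] := psd_fcalcP hpsd.
have [WA [al [hWA ha eA]]] := psd_fcalcP (psd_ptraceB hpsd).
have [WB [be [hWB hb eB]]] := psd_fcalcP (psd_ptraceA hpsd).
pose W := WA *t WB.
pose mu k := al (mxtens_unindex k).1 * be (mxtens_unindex k).2.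
have hW : unitary W by apply: unitary_tens.
have hmu k : 0 <= mu k by rewrite mulr_ge0.
exists ('I_(dA * dB) * 'I_(dA * dB))%type, (ns_law U W lam mu), (ns_llr lam mu (mutual_info rho)).
split.
- by move=> k; apply: ns_law_ge0.
- exact: (sum_ns_law1 hrho hU hWA hWB hl ha hb erho eA eB).
- exact: (mean_ns_llr hrho hU hWA hWB hl ha hb erho eA eB).
- exact: (var_ns_llr hrho hU hWA hWB hl ha hb erho eA eB).
move=> n.
have hrn : density (tpowAB n rho) by apply: (density_gpow (digitAB_bij dA dB n)).
have [hrnp hrnt] := hrn.
have [Un [ell [hUn hell ern]]] := psd_fcalcP hrnp.
have hcA := universal_comm (@perm_inv_tpow R dA n (ptraceB rho)).
have hcB := universal_comm (@perm_inv_tpow R dB n (ptraceA rho)).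
have hpA : psd (tpow n (ptraceB rho)) by apply: (psd_gpow (digit_bij dA n)); apply: psd_ptraceB.
have hpB : psd (tpow n (ptraceA rho)) by apply: (psd_gpow (digit_bij dB n)); apply: psd_ptraceA.
(* The eigenbases on n copies are those shared with the universal operators, not powers of the
   one-copy bases; [spectral_mgf_pow] still identifies the moment generating function. *)
have [YA [mA [zA [hYA hmA hzA eYA eZA]]]] := commuting_fcalc hpA (@psd_universal R dA n) hcA.
have [YB [mB [zB [hYB hmB hzB eYB eZB]]]] := commuting_fcalc hpB (@psd_universal R dB n) hcB.
pose Y := YA *t YB.
pose mn k := mA (mxtens_unindex k).1 * mB (mxtens_unindex k).2.
pose zn k := zA (mxtens_unindex k).1 * zB (mxtens_unindex k).2.
have hY : unitary Y by apply: unitary_tens.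
have hmn k : 0 <= mn k by rewrite mulr_ge0.
have hzn k : 0 <= zn k by rewrite mulr_ge0.
have esig : tpow n (ptraceB rho) *t tpow n (ptraceA rho) = fcalc Y mn.
  by rewrite eYA eYB fcalc_tens.
have esig1 : ptraceB rho *t ptraceA rho = fcalc W mu by rewrite eA eB fcalc_tens.
pose c := n%:R * mutual_info rho.
pose p := ns_law Un Y ell mn; pose S := ns_llr ell mn c.
have hp k : 0 <= p k by apply: ns_law_ge0.
have hmgf u : \sum_k p k * expR (u * S k)
    = mgf (ns_law U W lam mu) (ns_llr lam mu (mutual_info rho)) u ^+ n.
  rewrite /mgf !ns_law_mgf // exprMn -expRM_natl.
  rewrite (spectral_mgf_pow (U := U) (W := W) (lam := lam) (mu := mu)) //.
  - by rewrite /c mulrN mulrCA.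
  - by rewrite -erho.
  - by rewrite -esig1 tpowAB_tens.
(* Total mass is the moment generating function at u = 0. *)
have hp1 : \sum_k p k = 1.
  have e0 (K : finType) (F G : K -> R) : \sum_k F k * expR (0 * G k) = \sum_k F k.
    by apply: eq_bigr => k _; rewrite mul0r expR0 mulr1.
  have := hmgf 0; rewrite /mgf !e0 => ->.
  by rewrite (sum_ns_law1 hrho hU hWA hWB hl ha hb erho eA eB) expr1n.
have hell1 : \sum_i ell i = 1 by rewrite -(sum_fcalc ell hUn) -ern hrnt.
pose g i j := ell i * overlap Un Y i j.
have hg i j : 0 <= g i j by rewrite mulr_ge0 ?overlap_ge0.
have hpg i j : p (i, j) <= g i j by rewrite /p /ns_law /=; case: ifP.
have sump (F : _ -> R) : \sum_k F k = \sum_i \sum_j F (i, j) :> R.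
  by rewrite pair_bigA; apply: eq_bigr => -[].
have hg1 : \sum_i \sum_j g i j = 1 by rewrite (sum_overlap ell hUn hY).
exists ('I_(dA ^ n * dB ^ n) * 'I_(dA ^ n * dB ^ n))%type, p, S.
split => // a x m.
have hm0 : 0 <= m by apply: expR_ge0.
split.
- have [T [hT hT1 hT2]] := test_achievability zn hUn hY hell (expR_gt0 (n%:R * (mutual_info rho + a))).
  apply: (@le_trans _ _ (Re (\tr (tpowAB n rho *m T)))).
    rewrite ern; apply: le_trans hT1; rewrite lerBlDr.
    have hMA : \sum_i \sum_j (if expR x * mA (mxtens_unindex j).1 < zA (mxtens_unindex j).1
        then g i j else 0) <= expR (- x) * (n.+1 ^ (dA * dA))%:R.
      apply: le_trans (ler_wpM2l (expR_ge0 _) (@mxtrace_universal R dA n)).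
      rewrite eZA sum_fcalc // [leLHS]exchange_big sum_tens_index.
      under eq_bigr do under eq_bigr do under eq_bigr do rewrite mxtens_indexK /=.
      apply: (@markov_marginal _ _ _ (fun i a b => g i (mxtens_index (a, b))) mA zA x) => // a'.
      by apply: marginalA => //; rewrite -ern ptraceB_tpowAB.
    have hMB : \sum_i \sum_j (if expR x * mB (mxtens_unindex j).2 < zB (mxtens_unindex j).2
        then g i j else 0) <= expR (- x) * (n.+1 ^ (dB * dB))%:R.
      apply: le_trans (ler_wpM2l (expR_ge0 _) (@mxtrace_universal R dB n)).
      rewrite eZB sum_fcalc // [leLHS]exchange_big sum_tens_index [leLHS]exchange_big.
      under eq_bigr do under eq_bigr do under eq_bigr do rewrite mxtens_indexK /=.
      apply: (@markov_marginal _ _ _ (fun i b a => g i (mxtens_index (a, b))) mB zB x) => // b'.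
      by apply: marginalB => //; rewrite -ern ptraceA_tpowAB.
    rewrite [X in _ <= _ + X]mulrDr; apply: le_trans (lerD (lexx _) (lerD hMA hMB)).
    rewrite big_mkcond sump -!big_split /=; apply: ler_sum => i _.
    rewrite [X in _ <= X + _]big_mkcond -!big_split /=; apply: ler_sum => j _.
    have hge0 (b : bool) : 0 <= (if b then g i j else 0) by case: b.
    have [hA|hA] := ltrP (expR x * mA (mxtens_unindex j).1) (zA (mxtens_unindex j).1).
      rewrite addrCA; apply: (@le_trans _ _ (g i j)).
        by case: ifP.
      by rewrite lerDl addr_ge0.
    have [hB|hB] := ltrP (expR x * mB (mxtens_unindex j).2) (zB (mxtens_unindex j).2).
      rewrite add0r addrC; apply: (@le_trans _ _ (g i j)).
        by case: ifP.
      by rewrite lerDl.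
    rewrite !addr0; case: ifP => // hS; rewrite /p /ns_law /=; case: ifP => // /andP[l0 m0].
    suff -> : expR (n%:R * (mutual_info rho + a)) * zn j <= ell i by [].
    (* Outside both Markov events each factor of z exceeds its factor of m by at most e^x; the shift
       2 x in the threshold for S compensates this. *)
    have hz : zn j <= expR (2 * x) * mn j.
      have -> : expR (2 * x) * mn j = (expR x * mA (mxtens_unindex j).1) * (expR x * mB (mxtens_unindex j).2).
        by rewrite (_ : 2 * x = x + x) ?expRD /mn; ring.
      by apply: ler_pM.
    apply: (le_trans (ler_wpM2l (expR_ge0 _) hz)).
    rewrite mulrA -expRD -[X in _ * X]lnK ?posrE // -expRD -[leRHS]lnK ?posrE //.
    rewrite ler_expR; move: hS; rewrite /S /ns_llr /c /=; lra.
  apply: alpha_hat_achieve => // sigma tau hs1 hs2 ht1 ht2.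
  have hdA := universal_dominates hs1 hs2; have hdB := universal_dominates ht1 ht2.
  apply: (le_trans (mxtrace_psd_le (proj1 hT)
    (psd_tens_mono hdA (proj1 hs1) (@psd_universal R dB n) hdB))).
  rewrite eZA eZB fcalc_tens -/zn -/Y.
  rewrite /m expRN -[leRHS]mulr1 ler_pdivlMl ?expR_gt0 //.
  by apply: (le_trans hT2); rewrite hell1.
- by rewrite lerD2l lerN2; apply: alpha_iid_le.
apply: alpha_iid_converse => // T hT; rewrite esig ern => hfeas.
(* E = e^(-2 x) / m with t = e^(-x) balances the two error terms: E m / t = t. *)
pose E := expR (n%:R * (mutual_info rho + a) - 2 * x).
apply: (le_trans (test_converse hUn hY hell hell1 hmn hT (expR_ge0 _ : 0 <= E) (expR_gt0 (- x)))).
have -> : 2 * expR (- x) = expR (- x) + expR (- x) by ring.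
rewrite addrA; apply: lerD; last first.
  rewrite ler_pdivrMr ?expR_gt0 //; apply: (le_trans (ler_wpM2l (expR_ge0 _) hfeas)).
  rewrite /E /m -!expRD ler_expR; lra.
apply: lerD => //.
(* p <= g and both have mass 1, so replacing g by p in the sum over bad pairs costs nothing. *)
have hd0 : \sum_i \sum_j (g i j - p (i, j)) = 0.
  under eq_bigr do rewrite sumrB.
  by rewrite sumrB hg1 -sump hp1 subrr.
rewrite -[leRHS]addr0 -[X in _ <= _ + X]hd0 [X in _ <= X + _]big_mkcond sump -big_split /=.
apply: ler_sum => i _; rewrite [leLHS]big_mkcond -big_split /=; apply: ler_sum => j _.
have hge0 (b : bool) : 0 <= (if b then p (i, j) else 0) by case: b.
case: ifPn => [hbad|_]; last by rewrite addr_ge0 // subr_ge0.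
have [h1|h1] := boolP ((0 < ell i) && (0 < mn j)); last first.
  have -> : p (i, j) = 0 by rewrite /p /ns_law /= (negbTE h1).
  by rewrite subr0 if_same add0r.
have /andP[l0 m0] := h1.
have -> : p (i, j) = g i j by rewrite /p /ns_law /= h1.
suff -> : n%:R * a - 2 * x <= S (i, j) by rewrite subrr addr0.
have : expR (n%:R * (mutual_info rho + a) - 2 * x + exp.ln (mn j)) <= expR (exp.ln (ell i)).
  by rewrite expRD !lnK ?posrE //; exact: ltW.
by rewrite ler_expR /S /ns_llr /c /=; lra.
Qed.
End FiniteBlocklength.

(** * Rates *)

Section Asymptotics.
Variable R : realType.
Implicit Types (h eps kappa : R).

Lemma rate_cvg h (t y : nat -> R) :
  (forall eps, 0 < eps -> \forall n \near \oo, [/\ 0 < t n,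
     expR (- (t n * (h + eps))) <= y n & y n <= expR (- (t n * (h - eps)))]) ->
  (fun n => - (t n)^-1 * ln (y n)) @ \oo --> h.
Proof.
move=> H; apply/cvgrPdist_le => eps eps0; near=> n.
have [t0 h1 h2] : [/\ 0 < t n, expR (- (t n * (h + eps))) <= y n
  & y n <= expR (- (t n * (h - eps)))] by near: n; apply: H.
have y0 : 0 < y n by apply: lt_le_trans h1; apply: expR_gt0.
have l1 : - (t n * (h + eps)) <= ln (y n) by rewrite -ler_expR lnK ?posrE.
have l2 : ln (y n) <= - (t n * (h - eps)) by rewrite -ler_expR lnK ?posrE.
have -> : h - - (t n)^-1 * ln (y n) = (t n * h + ln (y n)) / t n by field; rewrite gt_eqF.
rewrite normrM [`|(t n)^-1|]gtr0_norm ?invr_gt0 // ler_pdivrMr // ler_norml.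
apply/andP; split; lra.
Unshelve. all: by end_near. Qed.

(** Phrased with sqrt n because n a_n >= sqrt n eventually. The bound comes from the term of order 2
    D + 1 of the exponential series, while (n + 1)^D is at most (2 sqrt n)^(2 D). *)
Lemma poly_le_expR (D : nat) kappa : 0 < kappa ->
  exists c : R, forall n : nat, c <= Num.sqrt n%:R ->
    (n.+1 ^ D)%:R <= expR (kappa * Num.sqrt n%:R).
Proof.
move=> k0; pose m := (2 * D)%N.
exists (Num.max 1 (2 ^+ m * (m.+1`!)%:R / kappa ^+ m.+1)) => n.
rewrite ge_max => /andP[s1 s2]; set s := Num.sqrt n%:R in s1 s2 *.
have hs2 : s ^+ 2 = n%:R by rewrite /s sqr_sqrtr.
have s0 : 0 <= s by apply: sqrtr_ge0.
have hn : n.+1%:R <= (2 * s) ^+ 2.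
  rewrite -natr1 -hs2 exprMn; have : 1 <= s ^+ 2 by rewrite exprn_ege1.
  lra.
have h1 : (n.+1 ^ D)%:R <= (2 * s) ^+ m.
  rewrite natrX /m exprM; apply: lerXn2r => //; rewrite nnegrE ?ler0n //.
  exact: sqr_ge0.
apply: (le_trans h1).
have hks : 0 <= kappa * s by rewrite mulr_ge0 // ltW.
have := @expR_ge1Dxn R (kappa * s) m hks.
have hf : 0 < (m.+1`!)%:R :> R by rewrite ltr0n fact_gt0.
have hk : 0 < kappa ^+ m.+1 by rewrite exprn_gt0.
suff : (2 * s) ^+ m <= (kappa * s) ^+ m.+1 / (m.+1`!)%:R by lra.
rewrite ler_pdivlMr //.
move: s2; rewrite ler_pdivrMr // => s2.
have := ler_wpM2r (exprn_ge0 m s0) s2.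
rewrite !exprMn [s ^+ m.+1]exprS.
lra.
Qed.

Lemma expR_N1_le : expR (- 1) <= 2^-1 :> R.
Proof. by have := @expR_le_inv R 1 ler01; rewrite (_ : 1 + 1 = 2) //; ring. Qed.

Lemma expR_N2_le : expR (- 2) <= 3^-1 :> R.
Proof. by have := @expR_le_inv R 2 ltac:(lra); rewrite (_ : 1 + 2 = 3) //; ring. Qed.

Lemma expR_N3_le : expR (- 3) <= 4^-1 :> R.
Proof. by have := @expR_le_inv R 3 ltac:(lra); rewrite (_ : 1 + 3 = 4) //; ring. Qed.

(** * Eventual bounds along a moderate sequence *)

Section Sequence.
Variable a : nat -> R.
Hypotheses (a0 : forall n, 0 < a n) (acvg : a @ \oo --> (0 : R))
  (sacvg : (fun n => Num.sqrt (n%:R : R) * a n) @ \oo --> +oo).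

Lemma near_a_lt delta : 0 < delta -> \forall n \near \oo, a n < delta.
Proof. by move=> d0; apply: (cvgr_lt 0 acvg). Qed.

Lemma near_sqrt_mul_ge (c : R) : \forall n \near \oo, c <= Num.sqrt n%:R * a n.
Proof. by move/cvgryPge: sacvg => /(_ c). Qed.

Lemma near_nasq_ge (c : R) : \forall n \near \oo, c <= n%:R * a n ^+ 2.
Proof.
near=> n; have h : Num.max 1 c <= Num.sqrt n%:R * a n by near: n; apply: near_sqrt_mul_ge.
move: h; rewrite ge_max => /andP[h1 h2].
have -> : n%:R * a n ^+ 2 = (Num.sqrt n%:R * a n) ^+ 2 by rewrite exprMn sqr_sqrtr.
by apply: (le_trans h2); rewrite expr2 ler_peMl //; apply: le_trans h1.
Unshelve. all: by end_near. Qed.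

Lemma near_na_ge_sqrt : \forall n \near \oo, Num.sqrt n%:R <= n%:R * a n.
Proof.
near=> n; have h : 1 <= Num.sqrt n%:R * a n by near: n; apply: near_sqrt_mul_ge.
have -> : n%:R * a n = Num.sqrt n%:R * (Num.sqrt n%:R * a n).
  by rewrite mulrA -expr2 sqr_sqrtr.
by rewrite ler_peMr // sqrtr_ge0.
Unshelve. all: by end_near. Qed.

Lemma near_sqrt_ge (c : R) : \forall n \near \oo, c <= Num.sqrt n%:R.
Proof.
near=> n; have h : c ^+ 2 <= n%:R by near: n; apply: nbhs_infty_ger.
by apply: (le_trans (ler_norm c)); rewrite -sqrtr_sqr ler_sqrt.
Unshelve. all: by end_near. Qed.

(** With x = e1 n a / 2 the threshold only moves from a to a (1 - e1), which changes the rate by a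
    factor close to 1, while e^(-x) is negligible as n a dominates n a^2. *)
Lemma near_upper V eps : 0 < V -> 0 < eps ->
  forall (up : R -> R -> nat -> R) (y : nat -> R),
  (forall n x, y n <= up (a n) x n + 2 * expR (- x)) ->
  (forall e, 0 < e -> exists2 delta, 0 < delta & forall n b, 0 < b < delta -> forall x,
     n%:R * b = n%:R * a n - 2 * x ->
     up (a n) x n <= expR (- (n%:R * b ^+ 2 * ((2 * V)^-1 - e)))) ->
  \forall n \near \oo, y n <= expR (- (n%:R * a n ^+ 2 * ((2 * V)^-1 - eps))).
Proof.
move=> V0 eps0 up y hy hup; set h := (2 * V)^-1.
have h0 : 0 < h by rewrite invr_gt0 mulr_gt0.
(* The relative shift e1 costs at most 2 e1 h <= eps / 6 in the rate and e2 at most eps / 16,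
   together below eps / 2. *)
pose e1 := Num.min 2^-1 (eps / (12 * h)).
have e10 : 0 < e1 by rewrite lt_min invr_gt0 ltr0n divr_gt0 // mulr_gt0.
have e1h : e1 <= 2^-1 by rewrite ge_min lexx.
have e1e : 12 * h * e1 <= eps by rewrite mulrC -ler_pdivlMr ?mulr_gt0 // ge_min lexx orbT.
pose e2 := Num.min (eps / 16) h.
have e20 : 0 < e2 by rewrite lt_min h0 andbT divr_gt0.
have e2e : e2 <= eps / 16 by rewrite ge_min lexx.
have e2h : e2 <= h by rewrite ge_min lexx orbT.
clearbody e1 e2; have [delta d0 hd] := hup e2 e20.
near=> n.
have n1 : a n < delta by near: n; apply: near_a_lt.
have n2 : a n < e1 / (2 * (h + 1)) by near: n; apply: near_a_lt; rewrite divr_gt0 // mulr_gt0 // addr_gt0.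
(* The other half of eps gives a factor e^(-2) <= 1/3, which pays for the sum of the main term and
   twice e^(-x). *)
have n3 : 4 / eps <= n%:R * a n ^+ 2 by near: n; apply: near_nasq_ge.
have an0 := a0 n; set t := n%:R * a n ^+ 2 in n3 *.
have t0 : 0 <= t by rewrite mulr_ge0 ?sqr_ge0.
pose x := e1 * (n%:R * a n) / 2; pose b := a n * (1 - e1).
have hb : 0 < b < delta.
  rewrite /b mulr_gt0 //= ?subr_gt0; last lra.
  by apply: le_lt_trans n1; rewrite ler_piMr ?(ltW an0) //; lra.
have hx : n%:R * b = n%:R * a n - 2 * x by rewrite /b /x; field.
apply: (le_trans (hy n x)).
have u1 : up (a n) x n <= expR (- (t * (h - eps / 2))).
  apply: (le_trans (hd n b hb x hx)); rewrite ler_expR lerN2.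
  have -> : n%:R * b ^+ 2 * (h - e2) = t * ((1 - e1) ^+ 2 * (h - e2)) by rewrite /b /t; ring.
  apply: ler_wpM2l => //.
  have : (1 - 2 * e1) * (h - e2) <= (1 - e1) ^+ 2 * (h - e2).
    by apply: ler_wpM2r; nra.
  have : 0 <= e1 * e2 by rewrite mulr_ge0 ?ltW.
  nra.
have u2 : expR (- x) <= expR (- (t * (h - eps / 2))).
  rewrite ler_expR lerN2.
  have -> : t * (h - eps / 2) = (n%:R * a n) * (a n * (h - eps / 2)) by rewrite /t; ring.
  have -> : x = (n%:R * a n) * (e1 / 2) by rewrite /x; ring.
  apply: ler_wpM2l; first by rewrite mulr_ge0 // ltW.
  have : a n * (2 * (h + 1)) <= e1 by rewrite -ler_pdivlMr ?ltW // mulr_gt0 // addr_gt0.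
  have : 0 <= a n * eps by rewrite mulr_ge0 ?ltW.
  nra.
have u3 : 3 * expR (- (t * (h - eps / 2))) <= expR (- (t * (h - eps))).
  have -> : - (t * (h - eps / 2)) = - (t * (h - eps)) + - (t * eps / 2) by field.
  rewrite expRD mulrCA -[leRHS]mulr1; apply: ler_wpM2l; first exact: expR_ge0.
  have : expR (- (t * eps / 2)) <= 3^-1.
    apply: le_trans expR_N2_le; rewrite ler_expR lerN2.
    by move: n3; rewrite ler_pdivrMr //; lra.
  lra.
lra.
Unshelve. all: by end_near. Qed.

(** Mirror image of [near_upper] with threshold a (1 + e1). Half of x swallows the polynomial
    factors, and the other half still makes the error at most half of the main term. *)
Lemma near_lower V eps D1 D2 : 0 < V -> 0 < eps ->
  forall (lo : R -> R -> nat -> R) (y : nat -> R),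
  (forall n x, lo (a n) x n - expR (- x) * ((n.+1 ^ D1)%:R + (n.+1 ^ D2)%:R) <= y n) ->
  (forall e, 0 < e -> exists2 delta, 0 < delta & exists c, forall n b, 0 < b < delta ->
     c <= n%:R * b ^+ 2 -> forall x, n%:R * b = n%:R * a n + 2 * x ->
     expR (- (n%:R * b ^+ 2 * ((2 * V)^-1 + e))) <= lo (a n) x n) ->
  \forall n \near \oo, expR (- (n%:R * a n ^+ 2 * ((2 * V)^-1 + eps))) <= y n.
Proof.
move=> V0 eps0 lo y hy hlo; set h := (2 * V)^-1.
have h0 : 0 < h by rewrite invr_gt0 mulr_gt0.
pose e1 := Num.min 2^-1 (eps / (12 * h)).
have e10 : 0 < e1 by rewrite lt_min invr_gt0 ltr0n divr_gt0 // mulr_gt0.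
have e1h : e1 <= 2^-1 by rewrite ge_min lexx.
have e1e : 12 * h * e1 <= eps by rewrite mulrC -ler_pdivlMr ?mulr_gt0 // ge_min lexx orbT.
clearbody e1; have e20 : 0 < eps / 16 by rewrite divr_gt0.
have [delta d0 [c hd]] := hlo _ e20.
have k0 : 0 < e1 / 4 by rewrite divr_gt0.
have [c1 hc1] := poly_le_expR D1 k0; have [c2 hc2] := poly_le_expR D2 k0.
near=> n.
have n1 : a n < delta / 2 by near: n; apply: near_a_lt; rewrite divr_gt0.
(* The summand 1 leaves a spare n a^2 in the exponent; being at least 3, it gives the factor e^(-3)
   <= 1/4 that offsets the 2 in [p12]. *)
have n2 : a n < e1 / (4 * (h + eps / 2 + 1)).
  by near: n; apply: near_a_lt; rewrite divr_gt0 // mulr_gt0 // !addr_gt0 // divr_gt0.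
have n3 : Num.max c (Num.max 3 (2 / eps)) <= n%:R * a n ^+ 2 by near: n; apply: near_nasq_ge.
have n4 : Num.max c1 c2 <= Num.sqrt n%:R by near: n; apply: near_sqrt_ge.
have n5 : Num.sqrt n%:R <= n%:R * a n by near: n; apply: near_na_ge_sqrt.
move: n3 n4; rewrite !ge_max => /andP[n3 /andP[n3' n3'']] /andP[n4 n4'].
have an0 := a0 n; set t := n%:R * a n ^+ 2 in n3 n3' n3'' *.
have t0 : 0 <= t by rewrite mulr_ge0 ?sqr_ge0.
have na0 : 0 <= n%:R * a n by rewrite mulr_ge0 // ltW.
pose x := e1 * (n%:R * a n) / 2; pose b := a n * (1 + e1).
have hb : 0 < b < delta.
  rewrite /b mulr_gt0 //= ?addr_gt0 //; nra.
have hx : n%:R * b = n%:R * a n + 2 * x by rewrite /b /x; field.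
have hbt : n%:R * b ^+ 2 = t * (1 + e1) ^+ 2 by rewrite /b /t; ring.
have hcb : c <= n%:R * b ^+ 2.
  apply: (le_trans n3); rewrite hbt ler_peMr // exprn_ege1 //; lra.
apply: le_trans (hy n x).
have u1 : expR (- (t * (h + eps / 2))) <= lo (a n) x n.
  apply: le_trans (hd n b hb hcb x hx); rewrite ler_expR lerN2 hbt -mulrA -/h.
  apply: ler_wpM2l => //.
  have : (1 + e1) ^+ 2 * (h + eps / 16) <= (1 + 3 * e1) * (h + eps / 16).
    by apply: ler_wpM2r; nra.
  have -> : (1 + 3 * e1) * (h + eps / 16) = h + eps / 16 + (12 * h * e1) / 4 + 3 / 16 * (e1 * eps).
    by field.
  have : e1 * eps <= 2^-1 * eps by apply: ler_wpM2r => //; exact: ltW.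
  lra.
have p12 : (n.+1 ^ D1)%:R + (n.+1 ^ D2)%:R <= 2 * expR (e1 / 4 * (n%:R * a n)).
  have hm : expR (e1 / 4 * Num.sqrt n%:R) <= expR (e1 / 4 * (n%:R * a n)).
    by rewrite ler_expR ler_wpM2l // ltW.
  have := le_trans (hc1 n n4) hm; have := le_trans (hc2 n n4') hm; lra.
have u2 : expR (- x) * ((n.+1 ^ D1)%:R + (n.+1 ^ D2)%:R)
    <= 2^-1 * expR (- (t * (h + eps / 2))).
  apply: (le_trans (ler_wpM2l (expR_ge0 _) p12)).
  rewrite mulrCA -expRD.
  have : expR (- x + e1 / 4 * (n%:R * a n)) <= expR (- (t * (h + eps / 2)) + - 3).
    rewrite ler_expR.
    have -> : - x + e1 / 4 * (n%:R * a n) = - (n%:R * a n * (e1 / 4)) by rewrite /x; field.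
    have : n%:R * a n * (a n * (h + eps / 2 + 1)) <= n%:R * a n * (e1 / 4).
      apply: ler_wpM2l => //.
      have : a n * (4 * (h + eps / 2 + 1)) <= e1.
        by rewrite -ler_pdivlMr ?ltW // mulr_gt0 // !addr_gt0 // divr_gt0.
      lra.
    have -> : n%:R * a n * (a n * (h + eps / 2 + 1)) = t * (h + eps / 2) + t by rewrite /t; ring.
    lra.
  have : expR (- (t * (h + eps / 2)) + - 3) <= expR (- (t * (h + eps / 2))) * 4^-1.
    rewrite [leLHS]expRD; apply: ler_wpM2l; [exact: expR_ge0 | exact: expR_N3_le].
  lra.
have u3 : expR (- (t * (h + eps))) <= 2^-1 * expR (- (t * (h + eps / 2))).
  have -> : - (t * (h + eps)) = - (t * (h + eps / 2)) + - (t * eps / 2) by field.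
  rewrite expRD mulrC; apply: ler_wpM2r; first exact: expR_ge0.
  apply: le_trans expR_N1_le; rewrite ler_expR lerN2.
  by move: n3''; rewrite ler_pdivrMr //; lra.
lra.
Unshelve. all: by end_near. Qed.
End Sequence.
End Asymptotics.

Theorem mainTheorem11 (R : realType) (dA dB : nat) (rho : 'M[R[i]]_(dA * dB))
  (a : nat -> R) :
  (forall n, 0 < a n) ->
  a @ \oo --> (0 : R) ->
  (fun n => Num.sqrt (n%:R : R) * a n) @ \oo --> +oo ->
  density rho ->
  0 < mutual_info_var rho ->
  let Rn := fun n : nat => mutual_info rho + a n in
  (fun n : nat => - (n%:R * a n ^+ 2)^-1
       * ln (1 - alpha_hat n rho (expR (- (n%:R * Rn n)))))
     @ \oo --> (2 * mutual_info_var rho)^-1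
  /\
  (fun n : nat => - (n%:R * a n ^+ 2)^-1
       * ln (1 - alpha_hat_iid n rho (expR (- (n%:R * Rn n)))))
     @ \oo --> (2 * mutual_info_var rho)^-1.
Proof.
move=> a0 acvg sacvg hrho V0 Rn.
set V := mutual_info_var rho in V0 *.
have [J [q [X [hq hq1 hmean hvar hlaw]]]] := sample_law_bounds hrho.
have hV : second_moment q X = V by [].
have hmgf := mgf_expR_bounds hq hq1 hmean; rewrite hV in hmgf.
have hM := fun k => hmgf k V0.
(* The law is fixed for each n once and for all, so that the tails are functions of n to which the
   asymptotic lemmas apply. *)
pose K n := projT1 (cid (hlaw n)).
pose p n : K n -> R := projT1 (cid (projT2 (cid (hlaw n)))).
pose S n : K n -> R := projT1 (cid (projT2 (cid (projT2 (cid (hlaw n)))))).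
have hn n : [/\ forall k, 0 <= p n k, forall u, \sum_k p n k * expR (u * S n k) = mgf q X u ^+ n
   & forall b x, let m := expR (- (n%:R * (mutual_info rho + b))) in
    [/\ \sum_(k | n%:R * b + 2 * x <= S n k) p n k
        - expR (- x) * ((n.+1 ^ (dA * dA))%:R + (n.+1 ^ (dB * dB))%:R)
         <= 1 - alpha_hat n rho m,
      1 - alpha_hat n rho m <= 1 - alpha_hat_iid n rho m &
      1 - alpha_hat_iid n rho m <= \sum_(k | n%:R * b - 2 * x <= S n k) p n k
         + 2 * expR (- x)]] by exact: (projT2 (cid (projT2 (cid (projT2 (cid (hlaw n))))))).
(* One chain encloses both quantities between the same exponentials; each limit then follows by
   transitivity through the other quantity. *)
have hall eps : 0 < eps -> \forall n \near \oo,
   [/\ 0 < n%:R * a n ^+ 2,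
     expR (- (n%:R * a n ^+ 2 * ((2 * V)^-1 + eps))) <= 1 - alpha_hat n rho (expR (- (n%:R * Rn n))),
     1 - alpha_hat n rho (expR (- (n%:R * Rn n))) <= 1 - alpha_hat_iid n rho (expR (- (n%:R * Rn n))) &
     1 - alpha_hat_iid n rho (expR (- (n%:R * Rn n))) <= expR (- (n%:R * a n ^+ 2 * ((2 * V)^-1 - eps)))].
  move=> eps0; near=> n; split.
  - by apply: (@lt_le_trans _ _ 1); [exact: ltr01 | near: n; apply: near_nasq_ge].
  - near: n; apply: (near_lower a0 acvg sacvg (D1 := dA * dA) (D2 := dB * dB) V0 eps0
      (lo := fun b x n => \sum_(k | n%:R * b + 2 * x <= S n k) p n k)).
      by move=> n x; have [_ _ /(_ (a n) x) []] := hn n.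
    move=> e e0; have [delta d0 [c hc]] := md_lower V0 e0 hM.
    exists delta => //; exists c => n b hb hcb x hx.
    by have [h1 h2 _] := hn n; rewrite -hx; apply: hc.
  (* The comparison of the two quantities is the same for every slack, so x = 0 serves. *)
  - by have [_ _ /(_ (a n) 0) []] := hn n.
  - near: n; apply: (near_upper a0 acvg sacvg V0 eps0
      (up := fun b x n => \sum_(k | n%:R * b - 2 * x <= S n k) p n k)).
      by move=> n x; have [_ _ /(_ (a n) x) []] := hn n.
    move=> e e0; have [delta d0 hc] := md_upper V0 e0 hM.
    exists delta => // n b hb x hx.
    by have [h1 h2 _] := hn n; rewrite -hx; apply: hc.
split; apply: rate_cvg => eps /hall; apply: filterS => n [h1 h2 h3 h4]; split => //.
  exact: le_trans h4.
exact: le_trans h3.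
Unshelve. all: by end_near. Qed.
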